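(* Suppose that the algebra $A(\xi)$ is such that $\alpha=\beta=1$ and $\nu\neq0$ (so $\chi_1^r=\chi_2^s=\epsilon$, $\chi_1\chi_2=\epsilon$ and $r=s$). Let $\eta\in F(\xi)$ and let $W(\eta)$ be the $B(\xi)$-module with basis $f_0,\dots,f_{r-1}$, subscripts taken modulo $r$. Set $c_0=c\neq0$, $c\in k$, and define a family of scalars $(c_i)_{0\le i\le r-1}$ inductively by $$c_i=q\left(c_{i-1}-\nu\left((\eta\chi_1^{i-1})(g_1g_2)-1\right)\right)=q\left(c_{i-1}+\nu-\nu q^{2(i-1)}\eta(g_1g_2)\right),\qquad i>0.$$ Define an operator $y$ on $W(\eta)$ by $y.f_i=c_if_{i-1}$. (i) This (together with the given action of $x$ and of $\Gamma$ on $W(\eta)$) defines a representation of $A(\xi)$ if and only if $c$ is a solution of the equation $$c_0c_1\cdots c_{r-1}=1.\qquad( * )$$ If this is the case, denote this $A(\xi)$-module by $L(\eta,c)$. Furthermore, $L(\eta,c)$ is irreducible. (ii) Let also $\eta'\in F(\xi)$ and let $c'$ be a solution of the equation $( * )$ associated with $\eta'$; let $(c'_i)$ be the scalars defined by $c'_0=c'$ and $c'_i=q\left(c'_{i-1}-\nu\left((\eta'\chi_1^{i-1})(g_1g_2)-1\right)\right)=q\left(c'_{i-1}+\nu-\nu q^{2(i-1)}\eta'(g_1g_2)\right)$ for $i>0$ (subscripts taken modulo $r$). Then $L(\eta,c)\simeq L(\eta',c')$ if and only if, for some integer $m$, $\eta=\eta'\chi_1^m$ and $c=c'_m$. (iii)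 Assume that the equation $( * )$ associated with $\eta$, regarded as a polynomial equation in $c$, has simple roots. Then every irreducible $A(\xi)$-module is of this kind (that is, isomorphic to $L(\eta',c')$ for some $\eta'\in F(\xi)$ and some solution $c'$ of the equation $( * )$ associated with $\eta'$), and $A(\xi)$ is semisimple.
   Context: Let $k$ be an algebraically closed field of characteristic $0$, $\Gamma$ a finite abelian group, $\widehat{\Gamma}$ its group of characters $\Gamma\to k^\times$, with trivial character $\epsilon$. Let $g_1,g_2\in\Gamma$ and $\chi_1,\chi_2\in\widehat\Gamma$ with $\chi_1(g_2)\chi_2(g_1)=1$. Let $r>1$ be the order of $q:=\chi_1(g_1)$ and $s>1$ the order of $\chi_2(g_2)$. Let $\alpha_{11},\alpha_{22},\nu\in k$ be scalars such that: $\alpha_{11}=0$ if $g_1^r=1$ or $\chi_1^r\neq\epsilon$; $\alpha_{22}=0$ if $g_2^s=1$ or $\chi_2^s\ne\epsilon$; $\nu=0$ if $g_1g_2=1$ or $\chi_1\chi_2\neq\epsilon$. The lifting $A$ of the quantum plane is the pointed Hopf algebra (of dimension $|\Gamma|rs$) generated by the elements $h\in\Gamma$ (with the relations of the group $\Gamma$) and $x,y$, with relations $hx=\chi_1(h)xh$, $hy=\chi_2(h)yh$ ($h\in\Gamma$), $x^r=\alpha_{11}(g_1^r-1)$, $y^s=\alpha_{22}(g_2^s-1)$, $xy=\chi_2(g_1)yx+\nu(g_1g_2-1)$. Let $\Lambda=\{g\in\Gamma:\chi_1(g)=\chi_2(g)=1\}$, a subgroup of $\Gamma$ that is central in $A$.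 If $\alpha_{11}\ne0$ then $g_1^r\in\Lambda$, and if $\alpha_{22}\neq 0$ then $g_2^s\in\Lambda$. Fix $\xi\in\widehat\Lambda$ and put $\alpha=\alpha_{11}(\xi(g_1^r)-1)$ and $\beta=\alpha_{22}(\xi(g_2^s)-1)$ (understood to be $0$ when $\alpha_{11}=0$, resp. $\alpha_{22}=0$). The algebra $A(\xi)$ is the quotient of $A$ by the relations $g=\xi(g)1$ for $g\in\Lambda$; that is, it is generated by $x$, $y$ and $h\in\Gamma$ with the relations of $\Gamma$ and $g=\xi(g)$ ($g\in\Lambda$), $hx=\chi_1(h)xh$, $hy=\chi_2(h)yh$ ($h\in\Gamma$), $x^r=\alpha$, $y^s=\beta$, $xy=\chi_2(g_1)yx+\nu(g_1g_2-1)$. Its dimension is $|\Gamma|rs/|\Lambda|$. Let $F(\xi)=\{\eta\in\widehat\Gamma:\eta|_\Lambda=\xi\}$. When $\chi_1\chi_2=\epsilon$ one has $q=\chi_1(g_1)=\chi_1(g_2)=\chi_2(g_1)^{-1}=\chi_2(g_2)^{-1}$, hence $r=s$. When $\alpha=1$ (so that $\chi_1^r=\epsilon$ and $\chi_1$ has order $r$), let $B(\xi)$ be the algebra generated by $x$ and $h\in\Gamma$ with the relations of $\Gamma$ and $g=\xi(g)$ ($g\in\Lambda$), $hx=\chi_1(h)xh$ ($h\in\Gamma$), $x^r=1$. For $\eta\in F(\xi)$, $W(\eta)$ is the $B(\xi)$-module with basis $f_i$, $i\in\mathbf{Z}/r$, and action $x.f_i=f_{i+1}$, $h.f_i=(\chi_1^i\eta)(h)f_i$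 for $h\in\Gamma$ (so $x.f_{r-1}=f_0$). The scalars $c_i$ defined by the recursion in the claim (continued to all $i\ge0$) depend only on $i$ modulo $r$. For given $\eta$, each $c_i$ is a polynomial in $c$, so $c_0c_1\cdots c_{r-1}=1$ is a polynomial equation in $c$ depending on $\eta$. *)

(* Defs.v *)
From HB Require Import structures.
From mathcomp Require Import all_boot all_order all_fingroup all_algebra.
From mathcomp Require Import boolp.
From mathcomp Require Import monalg.

Set Implicit Arguments.
Unset Strict Implicit.
Unset Printing Implicit Defensive.

Import GRing.Theory.
Local Open Scope ring_scope.
Local Open Scope quotient_scope.

Section FreeAlgebra.
Variables (k : fieldType) (I : choiceType).

Definition freeAlg := {malg k[{fmonom I}]}.
HB.instance Definition _ := GRing.Lalgebra.on freeAlg.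

Definition fgen (i : I) : freeAlg := mkmalgU (fmu i) 1.

Lemma freeAlg_scaleAr (c : k) (u v : freeAlg) : c *: (u * v) = u * (c *: v).
Proof.
apply/malgP => m; rewrite mcoeffZ.
rewrite [in RHS](mcoeffMlw _ (finmap.fsubset_refl (msupp u)) (msuppZ_le c v)).
rewrite mcoeffMl mulr_sumr; apply: eq_bigr => m1 _.
rewrite mulr_sumr; apply: eq_bigr => m2 _.
by rewrite mcoeffZ mulrCA mulrnAr.
Qed.

(* Two-sided ideal generated by the differences u - v with [rel u v]. *)
Inductive in_ideal (rel : freeAlg -> freeAlg -> Prop) : freeAlg -> Prop :=
| in_ideal_rel u v : rel u v -> in_ideal rel (u - v)
| in_ideal0 : in_ideal rel 0
| in_idealB u v : in_ideal rel u -> in_ideal rel v -> in_ideal rel (u - v)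
| in_idealMl u v : in_ideal rel v -> in_ideal rel (u * v)
| in_idealMr u v : in_ideal rel u -> in_ideal rel (u * v).

Variable rel : freeAlg -> freeAlg -> Prop.

Definition ideal_of : {pred freeAlg} := fun u => `[< in_ideal rel u >].

Lemma ideal_ofP u : reflect (in_ideal rel u) (u \in ideal_of).
Proof. exact: asboolP. Qed.

Fact ideal_of_zmod_closed : zmod_closed ideal_of.
Proof.
split; first exact/ideal_ofP/in_ideal0.
by move=> u v /ideal_ofP Iu /ideal_ofP Iv; apply/ideal_ofP/in_idealB.
Qed.
HB.instance Definition _ :=
  GRing.isZmodClosed.Build freeAlg ideal_of ideal_of_zmod_closed.

Definition presAlg := Quotient.quot ideal_of.
HB.instance Definition _ := GRing.Zmodule.on presAlg.
HB.instance Definition _ := ZmodQuotient.on presAlg.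

Local Notation repr := generic_quotient.repr.

Definition pr (u : freeAlg) : presAlg := \pi_presAlg u.

Lemma prP u v : reflect (pr u = pr v) (u - v \in ideal_of).
Proof. by rewrite Quotient.idealrBE; apply: eqP. Qed.

Lemma prK (a : presAlg) : pr (repr a) = a. Proof. exact: reprK. Qed.
Lemma prD u v : pr (u + v) = pr u + pr v. Proof. exact: pi_addr. Qed.

Definition presMul (a b : presAlg) : presAlg := pr (repr a * repr b).
Definition presScale (c : k) (a : presAlg) : presAlg := pr (c *: repr a).

Lemma prM u v : presMul (pr u) (pr v) = pr (u * v).
Proof.
apply/prP/ideal_ofP.
have -> : repr (pr u) * repr (pr v) - u * v
        = (repr (pr u) - u) * repr (pr v) - u * (v - repr (pr v)).
  by rewrite mulrBl mulrBr opprB addrA subrK.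
apply: in_idealB; [apply: in_idealMr|apply: in_idealMl].
  by apply/ideal_ofP/prP; rewrite prK.
by apply/ideal_ofP/prP; rewrite prK.
Qed.

Lemma prZ c u : presScale c (pr u) = pr (c *: u).
Proof.
apply/prP/ideal_ofP; rewrite -scalerBr -[X in c *: X]mul1r scalerAl.
by apply/in_idealMl/ideal_ofP/prP; rewrite prK.
Qed.

Fact presMulA : associative presMul.
Proof.
by move=> a b c; rewrite -[a]prK -[b]prK -[c]prK !prM mulrA.
Qed.
Fact presMul1l : left_id (pr 1) presMul.
Proof. by move=> a; rewrite -[a]prK prM mul1r. Qed.
Fact presMul1r : right_id (pr 1) presMul.
Proof. by move=> a; rewrite -[a]prK prM mulr1. Qed.
Fact presMulDl : left_distributive presMul +%R.
Proof.
by move=> a b c; rewrite -[a]prK -[b]prK -[c]prK -prD !prM -prD mulrDl.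
Qed.
Fact presMulDr : right_distributive presMul +%R.
Proof.
by move=> a b c; rewrite -[a]prK -[b]prK -[c]prK -prD !prM -prD mulrDr.
Qed.

(* Only a [pzRingType]: nothing prevents [rel] from killing 1. *)
HB.instance Definition _ := GRing.Zmodule_isPzRing.Build presAlg
  presMulA presMul1l presMul1r presMulDl presMulDr.

Fact presScaleA c d a : presScale c (presScale d a) = presScale (c * d) a.
Proof. by rewrite -[a]prK !prZ scalerA. Qed.
Fact presScale1 : left_id 1 presScale.
Proof. by move=> a; rewrite -[a]prK prZ scale1r. Qed.
Fact presScaleDr : right_distributive presScale +%R.
Proof. by move=> c a b; rewrite -[a]prK -[b]prK -prD !prZ -prD scalerDr. Qed.
Fact presScaleDl a : {morph presScale^~ a : c d / c + d}.
Proof. by move=> c d; rewrite -[a]prK !prZ -prD scalerDl. Qed.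

HB.instance Definition _ := GRing.Zmodule_isLmodule.Build k presAlg
  presScaleA presScale1 presScaleDr presScaleDl.

Fact pr_zmod_morphism : zmod_morphism pr.
Proof. by move=> u v; rewrite prD /pr pi_oppr. Qed.
HB.instance Definition _ :=
  GRing.isZmodMorphism.Build freeAlg presAlg pr pr_zmod_morphism.
Fact pr_monoid_morphism : monoid_morphism pr.
Proof. by split=> // u v; rewrite -prM. Qed.
HB.instance Definition _ :=
  GRing.isMonoidMorphism.Build freeAlg presAlg pr pr_monoid_morphism.
Fact pr_scalable : scalable pr.
Proof. by move=> c u; rewrite -prZ. Qed.
HB.instance Definition _ :=
  GRing.isScalable.Build k freeAlg presAlg _ pr pr_scalable.

Lemma pres_scaleAl (c : k) (a b : presAlg) : c *: (a * b) = (c *: a) * b.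
Proof.
by rewrite -[a]prK -[b]prK -rmorphM -!linearZ -rmorphM scalerAl.
Qed.
Lemma pres_scaleAr (c : k) (a b : presAlg) : c *: (a * b) = a * (c *: b).
Proof.
by rewrite -[a]prK -[b]prK -rmorphM -!linearZ -rmorphM freeAlg_scaleAr.
Qed.

Lemma pr_rel u v : rel u v -> pr u = pr v.
Proof. by move=> uv; apply/prP/ideal_ofP/in_ideal_rel. Qed.

End FreeAlgebra.

Section Modules.
Variable A : pzRingType.

(* Boolean predicates cover all subsets, thanks to [boolp]. *)
Definition irreducible_module (M : lmodType A) : Prop :=
  (exists v : M, v != 0) /\
  forall S : {pred M}, submod_closed S -> S =i pred1 0 \/ S =i predT.

Definition semisimple_module (M : lmodType A) : Prop :=
  forall S : {pred M}, submod_closed S ->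
  exists T : {pred M},
    [/\ submod_closed T,
        forall v, v \in S -> v \in T -> v = 0 &
        forall v, exists s t, [/\ s \in S, t \in T & v = s + t]].

Definition semisimple_algebra : Prop := semisimple_module (A^o : lmodType A).

Definition isomorphic_modules (M N : lmodType A) : Prop :=
  exists f : {linear M -> N}, bijective f.

End Modules.

(* k^n as column vectors: rho turns it into a left A-module. *)
Definition repmod (A : pzRingType) (k : fieldType) (n : nat)
  (rho : {rmorphism A -> 'M[k]_n}) : Type := 'cV[k]_n.

Section RepMod.
Variables (A : pzRingType) (k : fieldType) (n : nat).
Variable rho : {rmorphism A -> 'M[k]_n}.

HB.instance Definition _ := GRing.Zmodule.copy (repmod rho) 'cV[k]_n.

Definition rep_scale (a : A) (v : repmod rho) : repmod rho := rho a *m v.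

Fact rep_scaleA a b v : rep_scale a (rep_scale b v) = rep_scale (a * b) v.
Proof. by rewrite /rep_scale mulmxA rmorphM. Qed.
Fact rep_scale1 : left_id 1 rep_scale.
Proof. by move=> v; rewrite /rep_scale rmorph1 mul1mx. Qed.
Fact rep_scaleDr : right_distributive rep_scale +%R.
Proof. by move=> a u v; rewrite /rep_scale mulmxDr. Qed.
Fact rep_scaleDl v : {morph rep_scale^~ v : a b / a + b}.
Proof. by move=> a b; rewrite /rep_scale rmorphD mulmxDl. Qed.

HB.instance Definition _ := GRing.Zmodule_isLmodule.Build A (repmod rho)
  rep_scaleA rep_scale1 rep_scaleDr rep_scaleDl.

End RepMod.

(* Values are automatically nonzero: chi g * chi g^-1 = 1. *)
Definition is_char (k : fieldType) (gT : finGroupType) (H : {set gT})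
    (chi : gT -> k) : Prop :=
  chi 1%g = 1 /\ {in H &, {morph chi : g h / (g * h)%g >-> g * h}}.

Record qp_data (k : fieldType) (gT : finGroupType) := QPData {
  g1 : gT; g2 : gT;
  chi1 : gT -> k; chi2 : gT -> k;
  ordr : nat; ords : nat;
  a11 : k; a22 : k; nu : k
}.

Section QuantumPlane.
Variables (k : fieldType) (gT : finGroupType) (D : qp_data k gT).

Local Notation g1 := (g1 D).
Local Notation g2 := (g2 D).
Local Notation chi1 := (chi1 D).
Local Notation chi2 := (chi2 D).
Local Notation r := (ordr D).
Local Notation s := (ords D).
Local Notation nu := (nu D).

Record qp_axioms : Prop := QPAxioms {
  chi1_char : is_char [set: gT] chi1;
  chi2_char : is_char [set: gT] chi2;
  chi12_g21 : chi1 g2 * chi2 g1 = 1;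
  r_gt1 : (1 < r)%N;
  r_order : r.-primitive_root (chi1 g1);
  s_gt1 : (1 < s)%N;
  s_order : s.-primitive_root (chi2 g2);
  a11_eq0 : (g1 ^+ r = 1)%g \/ ~ (forall h, chi1 h ^+ r = 1) -> a11 D = 0;
  a22_eq0 : (g2 ^+ s = 1)%g \/ ~ (forall h, chi2 h ^+ s = 1) -> a22 D = 0;
  nu_eq0 : (g1 * g2 = 1)%g \/ ~ (forall h, chi1 h * chi2 h = 1) -> nu = 0
}.

Definition Lambda : {set gT} := [set g | (chi1 g == 1) && (chi2 g == 1)].

(* [xi] is meant to be a character of [Lambda]; its values outside [Lambda]
   are irrelevant (when a11 != 0, g1 ^+ r lies in [Lambda], and likewise for
   a22 and g2 ^+ s). *)
Variable xi : gT -> k.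

Definition alpha : k := a11 D * (xi (g1 ^+ r)%g - 1).
Definition beta : k := a22 D * (xi (g2 ^+ s)%g - 1).

Definition in_F (eta : gT -> k) : Prop :=
  is_char [set: gT] eta /\ {in Lambda, eta =1 xi}.

End QuantumPlane.

(* [inl true] = x, [inl false] = y, [inr h] = h. *)
Definition qp_gen (gT : finGroupType) : choiceType := (bool + gT)%type.

Section Axi.
Variables (k : fieldType) (gT : finGroupType) (D : qp_data k gT).
Variable xi : gT -> k.

Local Notation F := (freeAlg k (qp_gen gT)).
Definition freeX : F := fgen k (inl true : qp_gen gT).
Definition freeY : F := fgen k (inl false : qp_gen gT).
Definition freeH (h : gT) : F := fgen k (inr h : qp_gen gT).

Inductive Axi_rel : F -> F -> Prop :=
| rel_h1 : Axi_rel (freeH 1%g) 1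
| rel_hM g h : Axi_rel (freeH g * freeH h) (freeH (g * h)%g)
| rel_xi g : g \in Lambda D -> Axi_rel (freeH g) (xi g)%:A
| rel_hx h : Axi_rel (freeH h * freeX) (chi1 D h *: (freeX * freeH h))
| rel_hy h : Axi_rel (freeH h * freeY) (chi2 D h *: (freeY * freeH h))
| rel_xr : Axi_rel (freeX ^+ ordr D) (alpha D xi)%:A
| rel_ys : Axi_rel (freeY ^+ ords D) (beta D xi)%:A
| rel_xy : Axi_rel (freeX * freeY)
    (chi2 D (g1 D) *: (freeY * freeX)
     + nu D *: (freeH (g1 D * g2 D)%g - 1)).

Definition Axi := presAlg Axi_rel.
HB.instance Definition _ := GRing.PzRing.on Axi.
HB.instance Definition _ := GRing.Lmodule.on Axi.

Definition genX : Axi := pr Axi_rel freeX.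
Definition genY : Axi := pr Axi_rel freeY.
Definition genH (h : gT) : Axi := pr Axi_rel (freeH h).

End Axi.

Section ModuleL.
Variables (k : fieldType) (gT : finGroupType) (D : qp_data k gT).
Variable eta : gT -> k.

Local Notation r := (ordr D).
Local Notation q := (chi1 D (g1 D)).

(* (eta chi1^i)(g1 g2) - 1 *)
Definition cstep (i : nat) : k :=
  eta (g1 D * g2 D)%g * chi1 D (g1 D * g2 D)%g ^+ i - 1.

Fixpoint cseq (c : k) (i : nat) : k :=
  if i is j.+1 then q * (cseq c j - nu D * cstep j) else c.

(* The same recursion with c an indeterminate. *)
Fixpoint cpoly (i : nat) : {poly k} :=
  if i is j.+1 then q *: (cpoly j - (nu D * cstep j)%:P) else 'X.

Definition star (c : k) : Prop := \prod_(i < r) cseq c i = 1.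
Definition star_poly : {poly k} := \prod_(i < r) cpoly i - 1.

Definition simple_roots (p : {poly k}) : Prop :=
  forall a, root p a -> mup a p = 1%N.

Lemma horner_cpoly c i : (cpoly i).[c] = cseq c i.
Proof. by elim: i => [|i IHi] /=; rewrite !hornerE ?IHi. Qed.

Lemma star_polyP c : reflect (star c) (root star_poly c).
Proof.
rewrite /root /star_poly /star hornerD hornerN hornerC horner_prod subr_eq0.
under eq_bigr do rewrite horner_cpoly.
exact: eqP.
Qed.

Variable xi : gT -> k.

(* The basis f_i of W(eta), i in Z/r; [ordS] and [ord_pred] are the cyclic
   successor and predecessor on 'I_r. *)
Definition fbasis (i : 'I_r) : 'cV[k]_r := delta_mx i 0.

Definition defines_L (c : k) (rho : {rmorphism Axi D xi -> 'M[k]_r}) : Prop :=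
  [/\ scalable rho,
      forall i, rho (genX D xi) *m fbasis i = fbasis (ordS i),
      forall i, rho (genY D xi) *m fbasis i = cseq c i *: fbasis (ord_pred i) &
      forall h i, rho (genH D xi h) *m fbasis i
                  = (chi1 D h ^+ i * eta h) *: fbasis i].

End ModuleL.

(* c_i = q (c_{i-1} + nu - nu q^(2(i-1)) eta(g1 g2)); uses chi1 chi2 = 1. *)
Lemma cseqS (k : fieldType) (gT : finGroupType) (D : qp_data k gT)
    (eta : gT -> k) (c : k) (i : nat) :
  qp_axioms D -> nu D != 0 ->
  let q := chi1 D (g1 D) in
  cseq D eta c i.+1
  = q * (cseq D eta c i + nu D - nu D * q ^+ (2 * i) * eta (g1 D * g2 D)%g).
Proof.
move=> axD nu0 q /=; rewrite -/q.
have chi12 h : chi1 D h * chi2 D h = 1.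
  apply: contrapT => nh; case/eqP: nu0; apply: (nu_eq0 axD); right=> /(_ h).
  exact: nh.
have q2 : chi1 D (g2 D) = q.
  have q0 : chi2 D (g1 D) != 0.
    by apply/eqP => e; move/eqP: (chi12 (g1 D)); rewrite e mulr0 eq_sym oner_eq0.
  by apply: (mulIf q0); rewrite (chi12_g21 axD) chi12.
rewrite /cstep (chi1_char axD).2 ?inE // q2 -/q exprM expr2.
congr (_ * _); rewrite mulrBr mulr1 opprB addrA -mulrA.
by rewrite [eta _ * _]mulrC.
Qed.

(* Main.v *)
(* Put z = xy, which preserves the weight spaces of Gamma in any A(xi)-module M.
   On a vector w of weight eta one has y x^(n+1) w = x^n c_(n+1)(z) w, where
   c_i(z) is the polynomial in c defining c_i, evaluated at z. Hence
   w = y^r x^r w = c_1(z) ... c_r(z) w, and since c_r = c_0 the polynomial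
   c_0 ... c_(r-1) - 1 annihilates z on the weight space of eta. If its roots are
   simple, that weight space is the sum of the eigenspaces of z, and an eigenvector
   v for the eigenvalue c is the image of f_0 under the homomorphism
   L(eta,c) -> M, f_i |-> x^i v. Every weight in F(xi) is eta chi_1^i and x is
   invertible, so M is generated by such v, each generating a copy of an
   irreducible L(eta,c). This classifies the irreducible modules. For M = A(xi)
   finitely many v suffice to generate 1, and adding the simple submodules they
   generate one at a time yields a complement of any left ideal. *)
Require Import Defs.
From HB Require Import structures.
From mathcomp Require Import all_boot all_order all_fingroup all_algebra.
From mathcomp Require Import boolp monalg.

Set Implicit Arguments.
Unset Strict Implicit.
Unset Printing Implicit Defensive.

Import GRing.Theory.
Local Open Scope ring_scope.

(** * Linear representations of presented algebras *)

Section Free.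
Variables (k : fieldType) (I : choiceType).
Local Notation F := (freeAlg k I).

(** A word is a generator times a shorter word, so left multiplication by generators reaches every
    word from 1; linear combinations do the rest. *)
Lemma freeAlg_gen_ind (P : F -> Prop) :
  P 1 -> (forall u v, P u -> P v -> P (u + v)) ->
  (forall c u, P u -> P (c *: u)) -> (forall i u, P u -> P (fgen k i * u)) ->
  forall u, P u.
Proof.
move=> P1 PD PZ PM u.
have P0 : P 0 by rewrite -(scale0r 1); apply: PZ.
have Pm (s : seq I) : P (mkmalgU (FMonom s) 1).
  elim: s => [|i s IHs].
    by rewrite -fmoneE.
  have -> : mkmalgU (FMonom (i :: s)) 1 = fgen k i * mkmalgU (FMonom s) 1 :> F.
    rewrite [RHS](fgmulUU 1 1) mulr1.
    by rewrite fmuE; congr (mkmalgU _ 1); rewrite -[RHS]/(fmmul _ _) fmmulE.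
  exact: PM.
rewrite (monalgE u); elim/big_rec: _ => // m v _ Pv; apply: PD => //.
have -> : mkmalgU m u@_m = u@_m *: mkmalgU m 1 :> F.
  by apply/malgP => m'; rewrite mcoeffZ !mcoeffU mulr_natr.
by apply: PZ; rewrite -[m]fmK.
Qed.

(** Universal property of the free algebra: a word goes to the product of the images of its letters.
    The linear extension is multiplicative because scalar matrices are central. *)
Lemma freeAlg_lift n (h : I -> 'M[k]_n) : (0 < n)%N ->
  exists2 L : {rmorphism F -> 'M[k]_n}, scalable L & forall i, L (fgen k i) = h i.
Proof.
case: n h => // n h _.
pose hm (m : fmonom I) := \prod_(i <- (m : seq I)) h i.
have hmM : mmorphism hm.
  split=> [m1 m2|]; rewrite /hm.
    by rewrite -[mmul m1 m2]/(fmmul m1 m2) fmmulE big_cat.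
  by rewrite -[mone]/(fmone I) fmoneE big_nil.
pose hM : {mmorphism {fmonom I} -> 'M[k]_n.+1} :=
  HB.pack hm (monalg.isMultiplicative.Build _ _ hm hmM).
pose sc : {rmorphism k -> 'M[k]_n.+1} := @scalar_mx k n.+1.
pose L : F -> 'M[k]_n.+1 := mmap sc hM.
have LB : zmod_morphism L by exact: mmap_is_additive.
have LM : monoid_morphism L.
  have [] := @commr_mmap_is_multiplicative _ _ _ sc hM; last by split.
  by move=> g m m'; rewrite /GRing.comm /=; exact: comm_scalar_mx.
exists (HB.pack_for {rmorphism F -> 'M[k]_n.+1} L (GRing.isZmodMorphism.Build _ _ L LB)
  (GRing.isMonoidMorphism.Build _ _ L LM)).
  by move=> c u; rewrite /= /L mmapZ /= -mul_scalar_mx.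
move=> i; rewrite /= /L mmapU /= -[_ * _]/(_ *m _) mul1mx /hm fmuE.
by rewrite big_seq1.
Qed.

Section Presented.
Variable rel : F -> F -> Prop.
Local Notation A := (presAlg rel).

Lemma presAlg_gen_ind (P : A -> Prop) :
  P 1 -> (forall a b, P a -> P b -> P (a + b)) ->
  (forall c a, P a -> P (c *: a)) ->
  (forall i a, P a -> P (pr rel (fgen k i) * a)) ->
  forall a, P a.
Proof.
move=> P1 PD PZ PM a; rewrite -[a]prK; move: (generic_quotient.repr a) => {a}.
apply: freeAlg_gen_ind => [|u v Pu Pv|c u Pu|i u Pu].
- by rewrite rmorph1.
- by rewrite rmorphD; apply: PD.
- by rewrite linearZ; apply: PZ.
- by rewrite rmorphM; apply: PM.
Qed.

(** [rho] is [L] on a chosen representative; the choice is immaterial because [L] vanishes on the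
    whole ideal, by induction on its construction. *)
Lemma presAlg_lift n (L : {rmorphism F -> 'M[k]_n}) :
  scalable L -> (forall u v, rel u v -> L u = L v) ->
  exists2 rho : {rmorphism A -> 'M[k]_n},
    scalable rho & forall u, rho (pr rel u) = L u.
Proof.
move=> LZ Lrel.
have L0 u : in_ideal rel u -> L u = 0.
  elim=> {u} [u v /Lrel|| u v _ Lu _ Lv|u v _ Lv|u v _ Lu].
  - by rewrite rmorphB => ->; rewrite subrr.
  - by rewrite rmorph0.
  - by rewrite rmorphB Lu Lv subrr.
  - by rewrite rmorphM Lv mulr0.
  - by rewrite rmorphM Lu mul0r.
pose rho (a : A) := L (generic_quotient.repr a).
have rhoE u : rho (pr rel u) = L u.
  apply/eqP; rewrite -subr_eq0 /rho -rmorphB; apply/eqP/L0/ideal_ofP/prP.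
  by rewrite prK.
have rhoB : zmod_morphism rho.
  by move=> a b; rewrite -[a]prK -[b]prK -rmorphB !rhoE rmorphB.
have rhoM : monoid_morphism rho.
  split; first by rewrite -[1]/(pr rel 1) rhoE rmorph1.
  by move=> a b; rewrite -[a]prK -[b]prK -rmorphM !rhoE rmorphM.
exists (HB.pack_for {rmorphism A -> 'M[k]_n} rho
  (GRing.isZmodMorphism.Build _ _ rho rhoB)
  (GRing.isMonoidMorphism.Build _ _ rho rhoM)) => //=.
by move=> c a /=; rewrite -[a]prK -linearZ !rhoE LZ.
Qed.

End Presented.
End Free.

(** * Eigenvectors in modules over a ring with central scalars *)

Section CentralScalars.
Variables (k : fieldType) (A : pzRingType) (sc : {rmorphism k -> A}).
Hypothesis scC : forall c a, sc c * a = a * sc c.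

(* [horner_alg] is not available: [A] is not known to be nontrivial. *)
Definition peval (p : {poly k}) (z : A) : A := \sum_(i < size p) sc p`_i * z ^+ i.

Lemma peval_wide n (p : {poly k}) z :
  (size p <= n)%N -> peval p z = \sum_(i < n) sc p`_i * z ^+ i.
Proof.
move=> le_pn; rewrite /peval (big_ord_widen n (fun i => sc p`_i * z ^+ i)) //.
rewrite big_mkcond; apply: eq_bigr => i _.
by case: ltnP => // le_pi; rewrite nth_default // rmorph0 mul0r.
Qed.

Lemma pevalD p q z : peval (p + q) z = peval p z + peval q z.
Proof.
have [lep leq] := (leq_maxl (size p) (size q), leq_maxr (size p) (size q)).
rewrite (peval_wide z lep) (peval_wide z leq) (peval_wide z (size_polyD p q)).
rewrite -big_split /=.
by apply: eq_bigr => i _; rewrite coefD rmorphD mulrDl.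
Qed.

Lemma pevalZ c p z : peval (c *: p) z = sc c * peval p z.
Proof.
rewrite (@peval_wide (size p)) ?size_scale_leq // mulr_sumr.
by apply: eq_bigr => i _; rewrite coefZ rmorphM mulrA.
Qed.

Lemma pevalMX p z : peval (p * 'X) z = peval p z * z.
Proof.
rewrite (@peval_wide (size p).+1); last first.
  by rewrite (leq_trans (size_polyMleq _ _)) // size_polyX addn2.
rewrite big_ord_recl coefMX rmorph0 mul0r add0r mulr_suml.
by apply: eq_bigr => i _; rewrite coefMX /= /bump add1n -mulrA exprSr.
Qed.

Lemma pevalC c z : peval c%:P z = sc c.
Proof.
by rewrite (@peval_wide 1) ?size_polyC_leq1 // big_ord1 coefC mulr1.
Qed.

Lemma peval1 z : peval 1 z = 1.
Proof. by rewrite -polyC1 pevalC rmorph1. Qed.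

Lemma pevalX z : peval 'X z = z.
Proof. by rewrite -[in LHS](mul1r 'X) pevalMX peval1 mul1r. Qed.

Lemma pevalB p q z : peval (p - q) z = peval p z - peval q z.
Proof. by rewrite pevalD -scaleN1r pevalZ rmorphN1 mulN1r. Qed.

Lemma pevalM p q z : peval (p * q) z = peval p z * peval q z.
Proof.
elim/poly_ind: q => [|q c IHq].
  by rewrite mulr0 -polyC0 pevalC rmorph0 mulr0.
rewrite mulrDr mulrA !pevalD !pevalMX IHq mulrDr mulrA pevalC; congr (_ + _).
by rewrite (mulrC p) mul_polyC pevalZ scC.
Qed.

Lemma pevalXn n z : peval 'X^n z = z ^+ n.
Proof.
by elim: n => [|n IHn]; rewrite ?peval1 // !exprSr pevalM IHn pevalX.
Qed.

Variable M : lmodType A.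

(** The [k]-space structure that an [A]-module inherits through the central scalars. *)
Definition kscale c (v : M) : M := sc c *: v.
Local Notation "c .* v" := (kscale c v) (at level 40).

Lemma kscaleE c v : sc c *: v = c .* v. Proof. by []. Qed.

Lemma kscale_comm c (a : A) v : c .* (a *: v) = a *: (c .* v).
Proof. by rewrite /kscale !scalerA scC. Qed.

Lemma kscaleA c d v : c .* (d .* v) = (c * d) .* v.
Proof. by rewrite /kscale rmorphM scalerA. Qed.

Lemma kscale1 v : 1 .* v = v.
Proof. by rewrite /kscale rmorph1 scale1r. Qed.

Lemma kscale0 v : 0 .* v = 0.
Proof. by rewrite /kscale rmorph0 scale0r. Qed.

Lemma kscale0r c : c .* 0 = 0.
Proof. by rewrite /kscale scaler0. Qed.

Lemma kscaleN1 v : (- 1) .* v = - v.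
Proof. by rewrite /kscale rmorphN1 scaleN1r. Qed.

Lemma kscaleDl c d v : (c + d) .* v = c .* v + d .* v.
Proof. by rewrite /kscale rmorphD scalerDl. Qed.

Lemma kscaleDr c u v : c .* (u + v) = c .* u + c .* v.
Proof. by rewrite /kscale scalerDr. Qed.

Lemma kscaleBl c d v : (c - d) .* v = c .* v - d .* v.
Proof. by rewrite /kscale rmorphB scalerBl. Qed.

Lemma kscale_eq0 c v : c .* v = 0 -> c != 0 -> v = 0.
Proof.
move=> cv0 c0; rewrite -(kscale1 v) -(mulVf c0) -kscaleA cv0.
exact: kscale0r.
Qed.

Lemma peval_eigen p (z : A) (v : M) a : z *: v = a .* v ->
  peval p z *: v = p.[a] .* v.
Proof.
move=> zv; have zXv n : z ^+ n *: v = (a ^+ n) .* v.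
  elim: n => [|n IHn]; first by rewrite !expr0 kscale1 scale1r.
  by rewrite exprS -scalerA IHn -kscale_comm zv kscaleA -exprSr.
rewrite /peval horner_coef /kscale rmorph_sum !scaler_suml; apply: eq_bigr => i _.
by rewrite rmorphM -!scalerA zXv.
Qed.

(** The distinct roots are peeled off one at a time. [Q] stands for a [z]-stable subspace in which
    the eigenvectors have to stay, such as a weight space. *)
Lemma eigen_decomposition (z : A) (Q : M -> Prop) :
  (forall u v, Q u -> Q v -> Q (u + v)) -> (forall c v, Q v -> Q (c .* v)) ->
  (forall v, Q v -> Q (z *: v)) ->
  forall (s : seq k) (w : M), uniq s -> Q w ->
    peval (\prod_(a <- s) ('X - a%:P)) z *: w = 0 ->
  exists2 l : seq M, w = \sum_(v <- l) v &
    forall v, v \in l -> Q v /\ exists2 a, a \in s & z *: v = a .* v.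
Proof.
move=> QD QZ Qz; elim=> [|a s IHs] w.
  by rewrite big_nil peval1 scale1r => _ _ ->; exists [::]; rewrite ?big_nil.
rewrite cons_uniq => /andP[as' us] Qw.
rewrite big_cons pevalM pevalB pevalX pevalC.
set p := \prod_(b <- s) ('X - b%:P).
have pa0 : p.[a] != 0 by rewrite -[_ == 0]/(root p a) root_prod_XsubC.
(* [u = p(z) w] is an eigenvector; [p] kills [w - u / p(a)]. *)
rewrite -scalerA; set u := peval p z *: w => zu.
have {}zu : z *: u = a .* u.
  by apply/eqP; rewrite -subr_eq0 -scalerBl zu.
have Qu : Q u.
  have QX n : Q (z ^+ n *: w).
    elim: n => [|n IHn]; first by rewrite scale1r.
    by rewrite exprS -scalerA; apply: Qz.
  rewrite /u /peval scaler_suml; elim/big_rec: _ => [|i v _ Qv].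
    (* The empty sum is [0 .* w], hence in [Q] by closure under scaling. *)
    by have := QZ 0 w Qw; rewrite kscale0.
  by apply: QD => //; rewrite -scalerA; apply: QZ.
pose v := p.[a]^-1 .* u.
have zv : z *: v = a .* v by rewrite /v -kscale_comm zu !kscaleA mulrC.
have Qv : Q v by apply: QZ.
have [||l wl lP] := IHs (w - v) us.
- by apply: QD => //; rewrite -kscaleN1; apply: QZ.
- by rewrite scalerBr (peval_eigen _ zv) /v kscaleA divff // kscale1 subrr.
exists (v :: l); first by rewrite big_cons -wl addrC subrK.
move=> v'; rewrite inE => /predU1P[->|/lP[Qv' [b bs zv']]].
  by split=> //; exists a; rewrite ?mem_head.
by split=> //; exists b; rewrite // inE bs orbT.
Qed.

End CentralScalars.

(** * Irreducible and semisimple modules *)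

Section ModuleFacts.
Variable A : pzRingType.

Lemma isomorphic_modules_sym (M N : lmodType A) :
  isomorphic_modules M N -> isomorphic_modules N M.
Proof.
move=> [f [g fK gK]].
have gL : linear g.
  by move=> a u v; apply: (can_inj fK); rewrite linearP !gK.
exists (HB.pack_for {linear N -> M} g
  (GRing.isLinear.Build _ _ _ _ g gL)).
by exists f.
Qed.

Lemma irreducible_generated (M : lmodType A) (v : M) :
  irreducible_module M -> v != 0 -> forall w, exists a, w = a *: v.
Proof.
move=> [_ irrM] v0.
pose S : {pred M} := fun w => `[< exists a, w = a *: v >].
have Scl : submod_closed S.
  split; first by apply/asboolP; exists 0; rewrite scale0r.
  move=> a u w /asboolP[b ->] /asboolP[c ->]; apply/asboolP.
  by exists (a * b + c); rewrite scalerDl scalerA.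
have [S0|ST] := irrM S Scl; last first.
  by move=> w; apply/asboolP; move: (ST w); rewrite !inE.
have := S0 v; rewrite [RHS]inE (negPf v0) => /asboolP[].
by exists 1; rewrite scale1r.
Qed.

Lemma irreducible_generatedP (M : lmodType A) :
  (exists v : M, v != 0) ->
  (forall v w : M, v != 0 -> exists a, w = a *: v) -> irreducible_module M.
Proof.
move=> M0 gen; split=> // S [S0 Slin].
have [[v [Sv v0]]|Sn] := pselect (exists v, v \in S /\ v != 0).
  right=> w; rewrite inE; have [a ->] := gen v w v0.
  by rewrite -[_ *: _]addr0 Slin.
left=> w; rewrite inE; apply/idP/eqP => [Sw|-> //].
by apply/eqP; apply: contrapT => /negP w0; apply: Sn; exists w.
Qed.

Lemma schur (M N : lmodType A) (f : {linear M -> N}) (v : M) :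
  irreducible_module M -> irreducible_module N -> f v != 0 -> bijective f.
Proof.
move=> irrM irrN fv0.
have f0 u : f u = 0 -> u = 0.
  move=> fu; apply/eqP; apply: contraNT fv0 => u0.
  by have [a ->] := irreducible_generated irrM u0 v; rewrite linearZ /= fu scaler0.
have finj : injective f.
  by move=> u w fuw; apply/subr0_eq/f0; rewrite linearB fuw subrr.
have fsurj w : exists u, f u = w.
  by have [a ->] := irreducible_generated irrN fv0 w; exists (a *: v); rewrite linearZ.
have [g gK] := choice fsurj.
by exists g => [u|w //]; apply: finj; rewrite gK.
Qed.

(* The submodule generated by [v] is zero or simple. *)
Definition simple_vector (M : lmodType A) (v : M) :=
  forall a : A, a *: v != 0 -> exists b : A, b *: (a *: v) = v.

Definition in_sum (M : lmodType A) (S T : {pred M}) (v : M) :=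
  exists s t, [/\ s \in S, t \in T & v = s + t].

Lemma in_sum_closed (M : lmodType A) (S T : {pred M}) :
  submod_closed S -> submod_closed T -> submod_closed (fun v => `[< in_sum S T v >]).
Proof.
move=> [S0 Sl] [T0 Tl]; split.
  by apply/asboolP; exists 0, 0; rewrite addr0.
move=> a u v /asboolP[s [t [Ss Tt ->]]] /asboolP[s' [t' [Ss' Tt' ->]]].
apply/asboolP; exists (a *: s + s'), (a *: t + t'); split; [exact: Sl|exact: Tl|].
by rewrite scalerDr addrACA.
Qed.

(** [T] is built along [l]: a vector already in [S + T] changes nothing, and any other [v] enlarges
    [T] to [T + A v]. *)
Lemma simple_vectors_complement (M : lmodType A) (l : seq M) (S : {pred M}) :
  submod_closed S -> (forall v, v \in l -> simple_vector v) ->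
  exists T : {pred M}, [/\ submod_closed T,
    forall v, v \in S -> v \in T -> v = 0 & forall v, v \in l -> in_sum S T v].
Proof.
move=> Scl; elim: l => [|v l IHl] sl.
  exists (fun v => v == 0); split=> //; last by move=> v _ /eqP.
  split=> [|a u w /eqP-> /eqP->]; first exact: eqxx.
  by rewrite scaler0 addr0; exact: eqxx.
have [w lw|T [Tcl ST0 Tl]] := IHl; first by apply: sl; rewrite inE lw orbT.
have [vST|vST] := pselect (in_sum S T v).
  by exists T; split=> // w; rewrite inE => /predU1P[->|/Tl].
have STcl := in_sum_closed Scl Tcl.
pose T' : {pred M} := fun w => `[< exists t a, t \in T /\ w = t + a *: v >].
have [[S0 Sl] [T0 Tlin]] := (Scl, Tcl).
have TT' t : t \in T -> t \in T'.
  by move=> Tt; apply/asboolP; exists t, 0; rewrite scale0r addr0.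
exists T'; split.
- split; first exact: TT'.
  move=> a u w /asboolP[t [b [Tt ->]]] /asboolP[t' [c [Tt' ->]]]; apply/asboolP.
  exists (a *: t + t'), (a * b + c); split; first exact: Tlin.
  by rewrite scalerDr scalerDl scalerA addrACA.
- move=> w Sw /asboolP[t [a [Tt wE]]].
  have [av0|av0] := eqVneq (a *: v) 0.
    by apply: ST0 => //; rewrite wE av0 addr0.
  (* If [t + a *: v] lies in [S] and [a *: v] is nonzero, applying [b] writes [v] as an element of
     [S + T], against the choice of [v]. *)
  have [b bav] := sl v (mem_head _ _) a av0; case: vST.
  exists (b *: w), (- b *: t); split.
  + by rewrite -[_ *: _]addr0 Sl.
  + by rewrite -[_ *: _]addr0 Tlin.
  + by rewrite wE scalerDr bav scaleNr addrAC subrr add0r.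
- move=> w; rewrite inE => /predU1P[->|/Tl [s [t [Ss Tt ->]]]].
    exists 0, v; split; rewrite ?add0r //; apply/asboolP.
    by exists 0, 1; rewrite scale1r add0r.
  by exists s, t; split=> //; apply: TT'.
Qed.

(** The second hypothesis says that [l] generates 1. Once [S + T] contains [l] it contains 1, and
    multiplying a decomposition of 1 by [v] decomposes [v]. *)
Lemma semisimple_algebra_generated (l : seq (A^o : lmodType A)) :
  (forall v, v \in l -> simple_vector v) ->
  (forall S : {pred (A^o : lmodType A)}, submod_closed S ->
    (forall v, v \in l -> v \in S) -> (1 : A) \in S) ->
  semisimple_algebra A.
Proof.
move=> sl lS S Scl; have [T [Tcl ST0 lT]] := simple_vectors_complement Scl sl.
exists T; split=> // v.
have STcl := in_sum_closed Scl Tcl.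
have [s1 [t1 [Ss Tt e]]] : in_sum S T (1 : A).
  by apply/asboolP; apply: (lS _ STcl) => u ul; apply/asboolP/lT.
exists (v *: s1), (v *: t1); split.
- by have [S0 Sl] := Scl; rewrite -[_ *: _]addr0 Sl.
- by have [T0 Tl] := Tcl; rewrite -[_ *: _]addr0 Tl.
- by rewrite -scalerDr -e; apply/esym/mulr1.
Qed.

End ModuleFacts.

(** * The scalars [c_i] *)

Lemma sum_root_of_unity (R : idomainType) (x : R) n :
  x != 1 -> x ^+ n = 1 -> \sum_(j < n) x ^+ j = 0.
Proof.
rewrite -subr_eq0 => x1 xn; apply: (mulfI x1).
by rewrite -subrX1 xn subrr mulr0.
Qed.

(** Moving the window by one trades the factor [f n] for the equal factor [f (n + p)]. *)
Lemma prod_periodic_shift (R : comPzRingType) (p : nat) (f : nat -> R) :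
  (forall i, f (i + p)%N = f i) ->
  forall n, \prod_(i < p) f (n + i)%N = \prod_(i < p) f i.
Proof.
move=> fP; elim=> [|n IHn]; first by apply: eq_bigr => i _; rewrite add0n.
rewrite -{}IHn; case: p fP => [|p] fP; first by rewrite !big_ord0.
rewrite big_ord_recr [RHS]big_ord_recl /= addn0 mulrC.
congr (_ * _); last by apply: eq_bigr => i _; rewrite /= /bump add1n addSnnS.
by rewrite addSnnS fP.
Qed.

Lemma charX (k : fieldType) (gT : finGroupType) (chi : gT -> k) :
  is_char [set: gT] chi -> forall g n, chi (g ^+ n)%g = chi g ^+ n.
Proof.
by case=> c1 chiM g; elim=> // n IHn; rewrite expgS chiM ?inE // IHn exprS.
Qed.

Lemma char_neq0 (k : fieldType) (gT : finGroupType) (chi : gT -> k) :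
  is_char [set: gT] chi -> forall g, chi g != 0.
Proof.
case=> c1 chiM g; apply/eqP => g0.
have /eqP := chiM g g^-1%g (in_setT _) (in_setT _).
by rewrite mulgV c1 g0 mul0r oner_eq0.
Qed.

Section CharacterScalars.
Variables (k : fieldType) (gT : finGroupType) (D : qp_data k gT).
Variables xi eta : gT -> k.
Hypotheses (axD : qp_axioms D) (nu_neq0 : nu D != 0).
Hypothesis alpha1 : alpha D xi = 1.

Local Notation g1 := (g1 D).
Local Notation g2 := (g2 D).
Local Notation chi1 := (chi1 D).
Local Notation chi2 := (chi2 D).
Local Notation r := (ordr D).
Local Notation q := (chi1 g1).

Lemma ordr_gt0 : (0 < r)%N. Proof. exact: ltnW (r_gt1 axD). Qed.

Lemma chi1M g h : chi1 (g * h)%g = chi1 g * chi1 h.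
Proof. by rewrite (chi1_char axD).2 ?inE. Qed.

Lemma chi12 h : chi1 h * chi2 h = 1.
Proof.
apply: contrapT => nh; case/eqP: nu_neq0; apply: (nu_eq0 axD); right=> /(_ h).
exact: nh.
Qed.

Lemma chi1_neq0 h : chi1 h != 0. Proof. exact: char_neq0 (chi1_char axD) h. Qed.

Lemma chi2E h : chi2 h = (chi1 h)^-1.
Proof. by apply: (mulfI (chi1_neq0 h)); rewrite chi12 divff ?chi1_neq0. Qed.

Lemma chi1_g2 : chi1 g2 = q.
Proof.
by have := chi12_g21 axD; rewrite chi2E => /divr1_eq.
Qed.

Lemma chi1_g12 : chi1 (g1 * g2)%g = q ^+ 2.
Proof. by rewrite chi1M chi1_g2. Qed.

(** [chi2 g2] is the inverse of [q], so each of the two orders divides the other. *)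
Lemma ordsE : ords D = r.
Proof.
have := s_order axD; rewrite chi2E chi1_g2 => sq; have rq := r_order axD.
apply/eqP; rewrite eqn_dvd (prim_order_dvd sq) (prim_order_dvd rq).
rewrite exprVn (prim_expr_order rq) invr1 eqxx /=.
by rewrite -invr_eq1 -exprVn (prim_expr_order sq).
Qed.

(** [alpha = 1] forces [a11 D] to be nonzero, which the axioms allow only if the [r]-th power of
    [chi1] is trivial. *)
Lemma chi1_exp_r h : chi1 h ^+ r = 1.
Proof.
apply: contrapT => nh; have : a11 D = 0 by apply: (a11_eq0 axD); right=> /(_ h).
by move=> a0; move/eqP: alpha1; rewrite /alpha a0 mul0r eq_sym oner_eq0.
Qed.

Lemma cstepE i : cstep D eta i = eta (g1 * g2)%g * q ^+ (2 * i) - 1.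
Proof. by rewrite /cstep chi1_g12 exprM. Qed.

(** Dividing [c_i] by [q ^+ i] turns the recursion into a plain summation, leaving two geometric
    sums. *)
Lemma cpolyE i : cpoly D eta i = q ^+ i *:
  ('X - (nu D * \sum_(j < i) (eta (g1 * g2)%g * q ^+ j - q^-1 ^+ j))%:P).
Proof.
elim: i => [|i IHi]; first by rewrite big_ord0 mulr0 polyC0 subr0 scale1r.
rewrite /= {}IHi big_ord_recr /= cstepE exprS -scalerA; congr (_ *: _).
rewrite [in RHS](mulrDr (nu D)) polyCD opprD addrA [in RHS]scalerBr; congr (_ - _).
rewrite -mul_polyC -polyCM mulrCA; congr ((_ * _)%:P).
rewrite mulrBr mulrCA -exprD addnn -mul2n; congr (_ - _).
by rewrite exprVn divff // expf_neq0 ?chi1_neq0.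
Qed.

(** At [i = r] both geometric sums of [cpolyE] vanish, since [q] and its inverse are [r]-th roots of
    unity other than 1. *)
Lemma cpoly_r : cpoly D eta r = 'X.
Proof.
have q1 : q != 1.
  rewrite -[q]expr1 -(prim_order_dvd (r_order axD)) dvdn1.
  by rewrite gtn_eqF ?(r_gt1 axD).
rewrite cpolyE sumrB -mulr_sumr !sum_root_of_unity ?exprVn ?chi1_exp_r ?invr1 //.
  by rewrite mulr0 subr0 mulr0 polyC0 subr0 scale1r.
by rewrite invr_eq1.
Qed.

Lemma cpoly_periodic i : cpoly D eta (i + r) = cpoly D eta i.
Proof.
elim: i => [|i IHi]; first exact: cpoly_r.
by rewrite addSn /= IHi /cstep exprD chi1_exp_r mulr1.
Qed.

Lemma cseq_periodic c i : cseq D eta c (i + r) = cseq D eta c i.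
Proof. by rewrite -!horner_cpoly cpoly_periodic. Qed.

Lemma cseq_mod c i : cseq D eta c (i %% r) = cseq D eta c i.
Proof.
rewrite {2}(divn_eq i r); elim: (i %/ r)%N => [|m IHm]; first by rewrite add0n.
by rewrite mulSn -addnA addnC cseq_periodic.
Qed.

Lemma star_shift c n : star D eta c -> \prod_(i < r) cseq D eta c (n + i) = 1.
Proof.
move=> cstar; rewrite -[RHS]cstar; apply: prod_periodic_shift.
exact: cseq_periodic.
Qed.

End CharacterScalars.

(** * Modules over the lifted quantum plane *)

Section QuantumPlaneModules.
Variables (k : fieldType) (gT : finGroupType) (D : qp_data k gT).
Variables xi eta : gT -> k.
Hypotheses (axD : qp_axioms D) (nu_neq0 : nu D != 0).
Hypotheses (alpha1 : alpha D xi = 1) (eta_F : in_F D xi eta).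

Local Notation g1 := (g1 D).
Local Notation g2 := (g2 D).
Local Notation chi1 := (chi1 D).
Local Notation chi2 := (chi2 D).
Local Notation r := (ordr D).
Local Notation q := (chi1 g1).

(* The relations of [A(xi)] for [alpha = beta = 1] and [s = r], in any ring. *)
Record qp_relations (A : pzRingType) (sc : {rmorphism k -> A}) (x y : A)
    (H : gT -> A) : Prop := QPRelations {
  qp_central : forall c a, sc c * a = a * sc c;
  qp_h1 : H 1%g = 1;
  qp_hM : forall g h, H g * H h = H (g * h)%g;
  qp_xi : forall g, g \in Lambda D -> H g = sc (xi g);
  qp_hx : forall h, H h * x = sc (chi1 h) * (x * H h);
  qp_hy : forall h, H h * y = sc (chi2 h) * (y * H h);
  qp_xr : x ^+ r = 1;
  qp_yr : y ^+ r = 1;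
  qp_xy : x * y = sc (chi2 g1) * (y * x) + sc (nu D) * (H (g1 * g2)%g - 1)
}.

Variables (A : pzRingType) (sc : {rmorphism k -> A}) (x y : A) (H : gT -> A).
Hypothesis relA : qp_relations sc x y H.
Let scC := qp_central relA.
Local Notation z := (x * y).

(** This is the recursion for the [c_i] at the level of operators: [z] plays the part of [c_(i-1)]
    and [y * x] that of [c_i]. It uses that [chi2 g1] is inverse to [q]. *)
Lemma yxE : y * x = sc q * (z - sc (nu D) * (H (g1 * g2)%g - 1)).
Proof.
rewrite (qp_xy relA) addrK mulrA -rmorphM (chi12 axD nu_neq0) rmorph1.
by rewrite mul1r.
Qed.

Lemma hX h n : H (h ^+ n)%g = H h ^+ n.
Proof.
elim: n => [|n IHn]; first exact: qp_h1 relA.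
by rewrite expgS -(qp_hM relA) IHn exprS.
Qed.

Lemma xnK i : (i <= r)%N -> x ^+ i * x ^+ (r - i) = 1.
Proof. by move=> ir; rewrite -exprD subnKC // (qp_xr relA). Qed.

Variable M : lmodType A.
Implicit Types v w : M.
Local Notation "c .* v" := (kscale sc c v) (at level 40).

Definition weight (e : gT -> k) v := forall h, H h *: v = e h .* v.

Lemma weight_ext e e' v : e =1 e' -> weight e v -> weight e' v.
Proof. by move=> ee' ev h; rewrite ev ee'. Qed.

Lemma weightD e v w : weight e v -> weight e w -> weight e (v + w).
Proof. by move=> ev ew h; rewrite scalerDr ev ew kscaleDr. Qed.

Lemma weightZ e c v : weight e v -> weight e (c .* v).
Proof.
by move=> ev h; rewrite -(kscale_comm scC) ev !kscaleA mulrC.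
Qed.

Lemma weight_x e v : weight e v -> weight (fun h => chi1 h * e h) (x *: v).
Proof.
move=> ev h; rewrite scalerA (qp_hx relA) -!scalerA ev -(kscale_comm scC).
by rewrite -[LHS]/(_ .* _) kscaleA.
Qed.

Lemma weight_y e v : weight e v -> weight (fun h => chi2 h * e h) (y *: v).
Proof.
move=> ev h; rewrite scalerA (qp_hy relA) -!scalerA ev -(kscale_comm scC).
by rewrite -[LHS]/(_ .* _) kscaleA.
Qed.

Lemma weight_z e v : weight e v -> weight e (z *: v).
Proof.
move=> ev; rewrite -scalerA.
apply: weight_ext (weight_x (weight_y ev)) => h.
by rewrite mulrA (chi12 axD nu_neq0) mul1r.
Qed.

Lemma weight_xn e v n :
  weight e v -> weight (fun h => chi1 h ^+ n * e h) (x ^+ n *: v).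
Proof.
move=> ev; elim: n => [|n IHn].
  by apply: weight_ext (_ : weight e _) => [h|]; rewrite ?mul1r ?scale1r.
rewrite exprS -scalerA; apply: weight_ext (weight_x IHn) => h.
by rewrite mulrA -exprS.
Qed.

Lemma weight_peval e v p : weight e v -> weight e (peval sc p z *: v).
Proof.
move=> ev; rewrite /peval scaler_suml; elim/big_rec: _ => [|i w _ ew].
  by move=> h; rewrite scaler0 kscale0r.
apply: weightD => //; rewrite -scalerA; apply: weightZ.
elim: (val i) => [|n IHn]; first by rewrite scale1r.
by rewrite exprS -scalerA; apply: weight_z.
Qed.

(** If [z] acts on [x ^+ m *: v] as [c_m(z)] does on [v], then [yxE] yields [c_(m+1)], since [g1 g2]
    is a scalar on that weight vector. Multiplying the result by [x] gives the assumption for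
    [m.+1]. *)
Lemma y_xS v n : weight eta v ->
  y *: (x ^+ n.+1 *: v) = x ^+ n *: (peval sc (cpoly D eta n.+1) z *: v).
Proof.
move=> ev.
have step m : z *: (x ^+ m *: v) = x ^+ m *: (peval sc (cpoly D eta m) z *: v) ->
    y *: (x ^+ m.+1 *: v) = x ^+ m *: (peval sc (cpoly D eta m.+1) z *: v).
  move=> zm; rewrite exprS -[in LHS]scalerA scalerA yxE -scalerA.
  rewrite scalerBl zm -scalerA scalerBl (weight_xn m ev) scale1r /=.
  rewrite pevalZ pevalB pevalC -(scalerA (sc q)) !kscaleE -(kscale_comm scC).
  congr (_ .* _); rewrite scalerBl scalerBr kscaleE -(kscale_comm scC).
  congr (_ - _); rewrite -[X in _ - X](kscale1 sc) -kscaleBl kscaleA /cstep.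
  by rewrite [eta _ * _]mulrC.
elim: n => [|n IHn]; apply: step.
  by rewrite !scale1r /= pevalX.
by rewrite -scalerA IHn [in RHS]exprS -[in RHS]scalerA.
Qed.

Lemma yn_xn v n : weight eta v ->
  y ^+ n *: (x ^+ n *: v) = peval sc (\prod_(i < n) cpoly D eta (1 + i)) z *: v.
Proof.
elim: n v => [|n IHn] v ev; first by rewrite big_ord0 peval1 !scale1r.
(* The innermost [y] produces the last factor [c_(n+1)(z)]; the vector it leaves still has weight
   [eta], so the induction applies to it. *)
rewrite [in y ^+ _]exprSr -scalerA y_xS // IHn; last exact: weight_peval.
by rewrite scalerA -(pevalM scC) big_ord_recr.
Qed.

(* [y^r x^r = 1], while [yn_xn] rewrites [y^r x^r] on a vector of weight [eta]
   as the product of the [c_i], evaluated at [c = xy]. *)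
Lemma star_poly_kills v : weight eta v -> peval sc (star_poly D eta) z *: v = 0.
Proof.
move=> ev; rewrite /star_poly -(prod_periodic_shift _ 1); last first.
  exact: cpoly_periodic axD nu_neq0 alpha1.
by rewrite pevalB scalerBl -yn_xn // (qp_xr relA) (qp_yr relA) peval1 !scale1r subrr.
Qed.

(* The relations satisfied by [f_0] in [L(eta, c)]. *)
Definition standard c v := weight eta v /\ z *: v = c .* v.

Lemma y_xS_standard c v n : standard c v ->
  y *: (x ^+ n.+1 *: v) = cseq D eta c n.+1 .* (x ^+ n *: v).
Proof.
by case=> ev zv; rewrite y_xS // (peval_eigen scC _ zv) horner_cpoly (kscale_comm scC).
Qed.

(** [chi1 h] is a power of the primitive root [q], so [h] differs from a power of [g1] by an element
    of [Lambda], which acts through [xi]. Thus the eigenvalue of [g1] determines the whole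
    weight. *)
Lemma g1_weight i v : H g1 *: v = (q ^+ i * eta g1) .* v ->
  weight (fun h => chi1 h ^+ i * eta h) v.
Proof.
have [etaC etaL] := eta_F.
move=> g1v h; have [j hj] := prim_rootP (r_order axD) (chi1_exp_r axD alpha1 h).
pose l := (h * (g1 ^+ j)^-1)%g; have hE : h = (l * g1 ^+ j)%g by rewrite mulgKV.
have chi1l : chi1 l = 1.
  apply: (mulIf (expf_neq0 j (chi1_neq0 axD g1))).
  by rewrite -(charX (chi1_char axD)) -(chi1M axD) -hE mul1r hj (charX (chi1_char axD)).
have lL : l \in Lambda D by rewrite inE chi2E // chi1l invr1 eqxx.
have g1jv n : H g1 ^+ n *: v = ((q ^+ i * eta g1) ^+ n) .* v.
  elim: n => [|n IHn]; first by rewrite kscale1 scale1r.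
  by rewrite exprS -scalerA IHn -(kscale_comm scC) g1v kscaleA -exprSr.
rewrite {1}hE -(qp_hM relA) -scalerA hX g1jv (qp_xi relA lL) -[LHS]/(_ .* _).
rewrite kscaleA hj -(etaL _ lL) hE etaC.2 ?inE // (charX etaC).
by rewrite exprMn -!exprM mulnC mulrCA.
Qed.

(** Since [g1 ^+ r] lies in [Lambda], it acts as the scalar [eta g1 ^+ r]. So [H g1] is annihilated
    by a polynomial with the distinct roots [q ^+ i * eta g1], and its eigenvectors are weight
    vectors by [g1_weight]. *)
Lemma weight_decomposition w :
  exists2 l : seq M, w = \sum_(v <- l) v &
    forall v, v \in l -> exists2 i, (i < r)%N & weight (fun h => chi1 h ^+ i * eta h) v.
Proof.
have [etaC etaL] := eta_F; have r0 := ordr_gt0 axD.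
have e0 : eta g1 != 0 by apply: char_neq0.
pose rs := [seq q ^+ i * eta g1 | i <- iota 0 r].
have rsu : uniq rs.
  rewrite map_inj_in_uniq ?iota_uniq // => i j; rewrite !mem_iota /= => ir jr.
  move/(mulIf e0)/eqP; rewrite (eq_prim_root_expr (r_order axD)).
  by rewrite !modn_small // => /eqP.
have rsE : \prod_(a <- rs) ('X - a%:P) = 'X^r - (eta g1 ^+ r)%:P.
  rewrite [RHS](@all_roots_prod_XsubC _ _ rs).
  - by rewrite (monicP (monicXnsubC _ r0)) scale1r.
  - by rewrite size_XnsubC // size_map size_iota.
  - apply/allP => _ /mapP[i _ ->]; rewrite /root !hornerE exprMn exprAC.
    by rewrite (prim_expr_order (r_order axD)) expr1n mul1r subrr.
  - by rewrite uniq_rootsE.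
have g1rL : (g1 ^+ r)%g \in Lambda D.
  by rewrite inE chi2E // (charX (chi1_char axD)) (chi1_exp_r axD alpha1) invr1 eqxx.
have [||||||l wl lP] :=
  @eigen_decomposition _ _ _ scC M (H g1) (fun _ => True) _ _ _ rs w => //.
  rewrite rsE pevalB pevalXn // pevalC -hX (qp_xi relA g1rL) -etaL //.
  by rewrite (charX etaC) subrr scale0r.
exists l => // v /lP[_ [_ /mapP[i + ->] zv]]; rewrite mem_iota => ir.
by exists i => //; apply: g1_weight.
Qed.

(* [w] lies in the submodule generated by finitely many elements of [P]. *)
Definition generated_by (P : M -> Prop) w := exists2 l : seq M,
  forall v, v \in l -> P v &
  forall S : {pred M}, submod_closed S -> (forall v, v \in l -> v \in S) -> w \in S.

Lemma generated_scale (P : M -> Prop) a w :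
  generated_by P w -> generated_by P (a *: w).
Proof.
case=> l lP lS; exists l => // S Scl /(lS _ Scl) wS; case: Scl => S0 Sl.
by rewrite -[_ *: _]addr0 Sl.
Qed.

Lemma generated_sum (P : M -> Prop) (s : seq M) :
  (forall v, v \in s -> generated_by P v) -> generated_by P (\sum_(v <- s) v).
Proof.
elim: s => [|v s IHs] sP.
  by rewrite big_nil; exists [::] => // S [].
have [l lP lS] := sP v (mem_head _ _).
have [|l' l'P l'S] := IHs; first by move=> u us; apply: sP; rewrite inE us orbT.
rewrite big_cons; exists (l ++ l') => [u|S Scl uS].
  by rewrite mem_cat => /orP[/lP|/l'P].
have [S0 Sl] := Scl; rewrite -[v]scale1r; apply: Sl.
  by apply: lS => // u ul; apply: uS; rewrite mem_cat ul.
by apply: l'S => // u ul; apply: uS; rewrite mem_cat ul orbT.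
Qed.

Lemma standard_generated (s : seq k) (a : k) : uniq s -> a != 0 ->
  star_poly D eta = a *: \prod_(c <- s) ('X - c%:P) ->
  forall w, generated_by (fun v => exists2 c, star D eta c & standard c v) w.
Proof.
move=> us a0 sE w; have [l -> lP] := weight_decomposition w.
apply: generated_sum => v /lP[i ir vi].
have {vi} ev : weight eta (x ^+ (r - i) *: v).
  apply: weight_ext (weight_xn (r - i) vi) => h.
  by rewrite mulrA -exprD subnK ?(ltnW ir) // (chi1_exp_r axD alpha1) mul1r.
(* As [x] is invertible, [v] is [x ^+ i] applied to the vector of weight [eta] just obtained, and
   only the latter needs generating. *)
rewrite -[v]scale1r -(xnK (ltnW ir)) -scalerA; apply: generated_scale.
set u := _ *: v in ev *.
have [||||||l' -> l'P] :=
  @eigen_decomposition _ _ _ scC M z (weight eta) _ _ _ s u => //.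
- exact: weightD.
- exact: weightZ.
- exact: weight_z.
- apply: (kscale_eq0 (sc := sc) _ a0).
  by rewrite -kscaleE scalerA -pevalZ -sE star_poly_kills.
apply: generated_sum => t tl; have [et [c cs zt]] := l'P t tl.
exists [:: t] => [_ /[1!inE] /eqP->|S _]; last by apply; rewrite mem_head.
exists c => //; apply/star_polyP.
by rewrite sE /root hornerZ mulf_eq0 (negPf a0) /= -/(root _ _) root_prod_XsubC.
Qed.

End QuantumPlaneModules.

(** * The modules [L(eta, c)]: irreducibility and the maps out of them *)

Section StandardModule.
Variables (k : fieldType) (gT : finGroupType) (D : qp_data k gT).
Variables xi eta : gT -> k.
Hypotheses (axD : qp_axioms D) (nu_neq0 : nu D != 0).
Hypotheses (alpha1 : alpha D xi = 1) (eta_F : in_F D xi eta).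

Local Notation g1 := (g1 D).
Local Notation chi1 := (chi1 D).
Local Notation r := (ordr D).
Local Notation q := (chi1 g1).
Let r0 := ordr_gt0 axD.

(* The basis of [W(eta)] indexed by all naturals, modulo [r]. *)
Definition fvec (n : nat) : 'cV[k]_r := fbasis (Ordinal (ltn_pmod n r0)).

Lemma fvec_ord (i : 'I_r) : fvec i = fbasis i.
Proof. by congr fbasis; apply: val_inj; rewrite /= modn_small. Qed.

Lemma fvecDr n : fvec (n + r) = fvec n.
Proof. by congr fbasis; apply: val_inj; rewrite /= modnDr. Qed.

Lemma fbasis_ordS n :
  fbasis (ordS (Ordinal (ltn_pmod n r0))) = fvec n.+1 :> 'cV[k]_r.
Proof. by congr fbasis; apply: val_inj; rewrite /= -addn1 modnDml addn1. Qed.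

Lemma fbasis_ord_pred n :
  fbasis (ord_pred (Ordinal (ltn_pmod n.+1 r0))) = fvec n :> 'cV[k]_r.
Proof.
congr fbasis; apply: val_inj; rewrite /= -subn1 -addnBA // modnDml.
by rewrite addnBA // addSn subn1 modnDr.
Qed.

(** Presents every index, 0 included, as a successor, the form in which the action of [y] is
    stated. *)
Lemma fvec_pred i : fvec i = fvec (i + r.-1).+1.
Proof. by rewrite -addnS prednK // fvecDr. Qed.

Lemma cvec_expand (v : 'cV[k]_r) : v = \sum_(i < r) v i 0 *: fvec i.
Proof.
apply/colP => j; rewrite summxE (bigD1 j) //= big1 ?addr0 => [|i ij].
  by rewrite fvec_ord !mxE !eqxx mulr1.
by rewrite fvec_ord !mxE eq_sym (negPf ij) mulr0.
Qed.

Lemma diag_coord (B : 'M[k]_r) (b : nat -> k) (v : 'cV[k]_r) (i : 'I_r) :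
  (forall n, B *m fvec n = b n *: fvec n) -> (B *m v) i 0 = b i * v i 0.
Proof.
move=> Bb; rewrite {1}[v]cvec_expand mulmx_sumr summxE (bigD1 i) //=.
rewrite big1 ?addr0 => [|j ij]; rewrite -scalemxAr Bb fvec_ord !mxE !eqxx.
  by rewrite mulr1 mulrC.
by rewrite eq_sym (negPf ij) !mulr0.
Qed.

Lemma mx_fvec_inj (B C : 'M[k]_r) :
  (forall n, B *m fvec n = C *m fvec n) -> B = C.
Proof.
move=> BC; apply/matrixP => i j; have := BC j; rewrite fvec_ord -!colE.
by move=> /colP/(_ i); rewrite !mxE.
Qed.

Variables (A : pzRingType) (sc : {rmorphism k -> A}) (x y : A) (H : gT -> A).
Hypothesis relA : qp_relations D xi sc x y H.
Let scC := qp_central relA.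
Local Notation z := (x * y).

Variables (rho : {rmorphism A -> 'M[k]_r}) (c : k).

Record standard_rep : Prop := StandardRep {
  rep_sc : forall a, rho (sc a) = a%:M;
  rep_x : forall i, rho x *m fbasis i = fbasis (ordS i);
  rep_y : forall i, rho y *m fbasis i = cseq D eta c i *: fbasis (ord_pred i);
  rep_h : forall h i, rho (H h) *m fbasis i = (chi1 h ^+ i * eta h) *: fbasis i
}.
Hypothesis rhoL : standard_rep.

Local Notation L := (repmod rho).
Local Notation fL n := (fvec n : L).
Local Notation "a .* v" := (kscale sc a v) (at level 40).

Lemma kscale_rep a (v : L) : a .* v = (a *: (v : 'cV[k]_r)).
Proof.
by rewrite -mul_scalar_mx -(rep_sc rhoL).
Qed.

Lemma x_fvec n : x *: fL n = fL n.+1.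
Proof. by rewrite -(fbasis_ordS n) -(rep_x rhoL). Qed.

Lemma xn_fvec m n : x ^+ m *: fL n = fL (n + m).
Proof.
elim: m => [|m IHm]; first by rewrite scale1r addn0.
by rewrite exprS -scalerA IHm x_fvec addnS.
Qed.

Lemma y_fvec n : y *: fL n.+1 = cseq D eta c n.+1 .* fL n.
Proof.
rewrite kscale_rep -(fbasis_ord_pred n) -(cseq_mod eta axD nu_neq0 alpha1 c n.+1).
exact: rep_y rhoL _.
Qed.

Lemma h_fvec h n : H h *: fL n = (chi1 h ^+ n * eta h) .* fL n.
Proof.
rewrite kscale_rep -(expr_mod n (chi1_exp_r axD alpha1 h)).
exact: rep_h rhoL _ _.
Qed.

Lemma z_fvec n : z *: fL n = cseq D eta c n .* fL n.
Proof.
rewrite -scalerA {1}fvec_pred y_fvec -(kscale_comm scC) x_fvec -fvec_pred.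
by rewrite -addnS prednK // (cseq_periodic eta axD nu_neq0 alpha1).
Qed.

Lemma fvec0_standard : standard eta sc x y H c (fL 0).
Proof. by split=> [h|]; rewrite ?h_fvec ?mul1r // z_fvec. Qed.

Lemma fvec_neq0 n : fL n != 0.
Proof.
apply/eqP => /colP/(_ (Ordinal (ltn_pmod n r0)))/eqP.
by rewrite !mxE !eqxx oner_eq0.
Qed.

(** [f_0] is an eigenvector of [z] with eigenvalue [c], and [star_poly] evaluated at [z] kills it;
    hence [c] is a root. *)
Lemma rep_star : star D eta c.
Proof.
have [ev zv] := fvec0_standard.
have := star_poly_kills axD nu_neq0 alpha1 relA ev.
rewrite (peval_eigen scC _ zv) => s0; apply/star_polyP; apply: contraT => sn0.
by have /eqP := kscale_eq0 s0 sn0; rewrite (negPf (fvec_neq0 0)).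
Qed.

Lemma fvec_sum (v : L) : v = \sum_(i < r) v i 0 .* fL i.
Proof. by rewrite {1}[v]cvec_expand; apply: eq_bigr => i _; rewrite kscale_rep. Qed.

Lemma standard_rep_irreducible : irreducible_module L.
Proof.
apply: irreducible_generatedP; first by exists (fL 0); apply: fvec_neq0.
move=> v w v0.
(* Powers of [x] carry [f_0] to every basis vector, so reaching [f_0] from [v] is enough. *)
suff [b bv] : exists b : A, b *: v = fL 0.
  exists ((\sum_(i < r) sc (w i 0) * x ^+ i) * b); rewrite -scalerA bv scaler_suml.
  rewrite [LHS]fvec_sum; apply: eq_bigr => i _.
  by rewrite -scalerA xn_fvec add0n.
have /cV0Pn[i vi0] := v0.
have e0 : eta g1 != 0 by apply: char_neq0; case: eta_F.
(* The [f_j] have distinct eigenvalues under [g1], and [p] vanishes at all of them but the [i]-th: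
   evaluated at [H g1] it is, up to a nonzero factor, the projection onto the line of [f_i]. *)
pose p := \prod_(j < r | j != i) ('X - (q ^+ j * eta g1)%:P).
pose b := peval sc p (H g1).
have bf n : b *: fL n = p.[q ^+ n * eta g1] .* fL n.
  by apply: peval_eigen => //; rewrite h_fvec.
have p0 (j : 'I_r) : j != i -> p.[q ^+ j * eta g1] = 0.
  by move=> ji; rewrite horner_prod (bigD1 j) //= !hornerE subrr mul0r.
have pi : p.[q ^+ i * eta g1] != 0.
  rewrite horner_prod; apply/prodf_neq0 => j ji; rewrite !hornerE subr_eq0.
  apply: contraNneq ji => /(mulIf e0)/eqP.
  rewrite (eq_prim_root_expr (r_order axD)) !modn_small // => /eqP ij.
  exact/eqP/val_inj.
have bv : b *: v = (v i 0 * p.[q ^+ i * eta g1]) .* fL i.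
  rewrite {1}[v]fvec_sum scaler_sumr (bigD1 i) //= big1 ?addr0 => [|j ji].
    by rewrite -(kscale_comm scC) bf kscaleA.
  by rewrite -(kscale_comm scC) bf kscaleA p0 // mulr0 kscale0.
(* Project to the line of [f_i], normalise the coefficient, then move [f_i] to [f_r], which is
   [f_0]. *)
exists (x ^+ (r - i) * sc (v i 0 * p.[q ^+ i * eta g1])^-1 * b).
rewrite -!scalerA bv kscaleE kscaleA mulVf ?mulf_neq0 // kscale1 xn_fvec.
by rewrite subnKC ?(ltnW (ltn_ord i)) // -[r in LHS]add0n fvecDr.
Qed.

Hypothesis genA : forall P : A -> Prop, P 1 ->
  (forall a b, P a -> P b -> P (a + b)) -> (forall a b, P b -> P (sc a * b)) ->
  (forall b, P b -> P (x * b)) -> (forall b, P b -> P (y * b)) ->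
  (forall h b, P b -> P (H h * b)) -> forall a, P a.

(** The map sends [f_i] to [x ^+ i *: v]. By [genA] its [A]-linearity need only be checked for the
    generators, and by [k]-linearity only on the basis. *)
Lemma standard_hom (M : lmodType A) (v : M) :
  standard eta sc x y H c v -> exists f : {linear L -> M}, f (fL 0) = v.
Proof.
move=> sv; have [ev zv] := sv.
pose f (u : L) : M := \sum_(i < r) u i 0 .* (x ^+ i *: v).
have fD u w : f (u + w) = f u + f w.
  by rewrite -big_split; apply: eq_bigr => i _; rewrite /= mxE kscaleDl.
have fZ a u : f (a .* u) = a .* f u.
  rewrite -[RHS]kscaleE scaler_sumr; apply: eq_bigr => i _.
  by rewrite kscale_rep mxE -kscaleA.
have f0 : f 0 = 0 by rewrite /f big1 // => i _; rewrite mxE kscale0.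
have fsum (I : Type) (s : seq I) (F : I -> L) :
    f (\sum_(i <- s) F i) = \sum_(i <- s) f (F i) by apply: big_morph.
have fF n : f (fL n) = x ^+ n *: v.
  rewrite /f (bigD1 (Ordinal (ltn_pmod n r0))) //= big1 ?addr0 => [|i ni].
    by rewrite mxE !eqxx kscale1 (expr_mod n (qp_xr relA)).
  by rewrite mxE (negPf ni) kscale0.
have fgen a : (forall n, f (a *: fL n) = a *: f (fL n)) ->
    forall u, f (a *: u) = a *: f u.
  move=> aF u; rewrite [u]fvec_sum scaler_sumr !fsum scaler_sumr.
  by apply: eq_bigr => i _; rewrite -(kscale_comm scC) !fZ aF (kscale_comm scC).
have fx := fgen x; have fy := fgen y; have fh h := fgen (H h).
have flin a u : f (a *: u) = a *: f u.
  elim/genA: a u => [|a b IHa IHb|a b IHb|b IHb|b IHb|h b IHb] u.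
  - by rewrite !scale1r.
  - by rewrite !scalerDl fD IHa IHb.
  - by rewrite -!scalerA !kscaleE fZ IHb.
  - by rewrite -!scalerA fx ?IHb // => n; rewrite x_fvec !fF exprS scalerA.
  - rewrite -!scalerA fy ?IHb // => n; rewrite fvec_pred y_fvec fZ !fF.
    by rewrite (y_xS_standard axD nu_neq0 relA _ sv).
  - rewrite -!scalerA fh ?IHb // => n; rewrite h_fvec fZ fF.
    by rewrite (weight_xn relA n ev).
have flinear : linear f by move=> a u w; rewrite fD flin.
exists (HB.pack_for {linear L -> M} f (GRing.isLinear.Build _ _ _ _ f flinear)).
by rewrite /= fF scale1r.
Qed.

Lemma standard_linear (e : gT -> k) a (M N : lmodType A) (f : {linear M -> N}) v :
  standard e sc x y H a v -> standard e sc x y H a (f v).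
Proof.
by case=> ev zv; split=> [h|]; rewrite /kscale -!linearZ ?ev ?zv.
Qed.

Lemma standard_fvec (e : gT -> k) n : (forall h, e h = chi1 h ^+ n * eta h) ->
  standard e sc x y H (cseq D eta c n) (fL n).
Proof. by move=> eE; split=> [h|]; rewrite ?h_fvec ?eE // z_fvec. Qed.

(** The group and [z] are simultaneously diagonal in the basis [f_i], so any nonzero coordinate of
    an eigenvector reveals its eigenvalues. *)
Lemma standard_coord (e : gT -> k) a (v : L) : standard e sc x y H a v -> v != 0 ->
  exists i : 'I_r, (forall h, e h = chi1 h ^+ i * eta h) /\ a = cseq D eta c i.
Proof.
case=> ev zv /cV0Pn[i vi0].
exists i; have coord (g : A) t (b : nat -> k) :
    (forall n, g *: fL n = b n .* fL n) -> g *: v = t .* v -> t = b i.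
  move=> gF; rewrite kscale_rep => gv; apply: (mulIf vi0).
  rewrite -(@diag_coord (rho g) b) => [|n]; last by rewrite -kscale_rep -gF.
  by rewrite -[_ *m _]/(g *: v) gv mxE.
split=> [h|]; first exact: coord (fun n => chi1 h ^+ n * eta h) (h_fvec h) (ev h).
exact: coord z_fvec zv.
Qed.

Lemma standard_iso (M : lmodType A) (v : M) : irreducible_module M ->
  standard eta sc x y H c v -> v != 0 -> isomorphic_modules L M.
Proof.
move=> irrM /standard_hom[f fv] v0; exists f.
by apply: (schur (v := fL 0)) => //; [exact: standard_rep_irreducible|rewrite fv].
Qed.

(** [v] is the image of [f_0]; in the irreducible [L], [f_0] is recovered from [a *: f_0], and the
    same multiplier recovers [v]. *)
Lemma standard_simple (M : lmodType A) (v : M) :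
  standard eta sc x y H c v -> simple_vector v.
Proof.
move=> /standard_hom[f fv] a av0.
have aF0 : a *: fL 0 != 0.
  by apply: contraNneq av0 => aF; rewrite -fv -linearZ /= aF linear0.
have [b bE] := irreducible_generated standard_rep_irreducible aF0 (fL 0).
by exists b; rewrite -fv -!linearZ -bE.
Qed.

End StandardModule.

(** * Scalars, relations and generators of [A(xi)] *)

Section ScalarsOfAxi.
Variables (k : fieldType) (gT : finGroupType) (D : qp_data k gT) (xi : gT -> k).

(* [_%:A] does not apply: [Axi] carries no canonical algebra structure. *)
Definition axi_scalar (c : k) : Axi D xi := pr (Axi_rel D xi) (c *: 1).

Fact axi_scalar_zmod_morphism : zmod_morphism axi_scalar.
Proof. by move=> c d; rewrite /axi_scalar scalerBl rmorphB. Qed.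
HB.instance Definition _ :=
  GRing.isZmodMorphism.Build k (Axi D xi) axi_scalar axi_scalar_zmod_morphism.

Fact axi_scalar_monoid_morphism : monoid_morphism axi_scalar.
Proof.
split; first by rewrite /axi_scalar scale1r.
by move=> c d; rewrite /axi_scalar -rmorphM -scalerAl mul1r scalerA.
Qed.
HB.instance Definition _ :=
  GRing.isMonoidMorphism.Build k (Axi D xi) axi_scalar axi_scalar_monoid_morphism.

Lemma axi_scalarE c : axi_scalar c = c *: (1 : Axi D xi).
Proof. by rewrite /axi_scalar linearZ rmorph1. Qed.

Lemma axi_scaleE c (a : Axi D xi) : c *: a = axi_scalar c * a.
Proof.
by rewrite -[a]prK -linearZ /axi_scalar -rmorphM -scalerAl mul1r.
Qed.

Local Notation p := (pr (Axi_rel D xi) : _ -> Axi D xi).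

Lemma axi_prM u v : p (u * v) = p u * p v.
Proof. exact: rmorphM. Qed.

Lemma axi_prZ c u : p (c *: u) = axi_scalar c * p u.
Proof.
have -> : c *: u = (c *: 1) * u by rewrite -scalerAl mul1r.
exact: axi_prM.
Qed.

Lemma axi_prX u n : p (u ^+ n) = p u ^+ n.
Proof. exact: rmorphXn. Qed.

Lemma axi_scalarC c (a : Axi D xi) : axi_scalar c * a = a * axi_scalar c.
Proof.
rewrite -[a]prK; move: (generic_quotient.repr a) => u.
have cu : (c *: 1) * u = u * (c *: 1).
  by rewrite -scalerAl mul1r -freeAlg_scaleAr mulr1.
exact: etrans (esym (axi_prM _ _)) (etrans (congr1 p cu) (axi_prM _ _)).
Qed.

Lemma axi_relations : qp_axioms D -> nu D != 0 ->
    alpha D xi = 1 -> beta D xi = 1 ->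
  qp_relations D xi axi_scalar (genX D xi) (genY D xi) (genH D xi).
Proof.
move=> axD nu0 a1 b1.
have p1 : p 1 = 1 by [].
have pc1 c : c = 1 -> p (c *: 1) = 1 by move=> ->; rewrite scale1r.
have twist h a u : Axi_rel D xi (freeH k h * u) (a *: (u * freeH k h)) ->
    p (freeH k h) * p u = axi_scalar a * (p u * p (freeH k h)).
  move=> hu; apply: etrans (esym (axi_prM _ _)) _.
  apply: etrans (pr_rel hu) _; apply: etrans (axi_prZ _ _) _.
  exact: congr1 (axi_prM _ _).
split.
- exact: axi_scalarC.
- exact: pr_rel (rel_h1 D xi).
- move=> g h; apply: etrans (esym (axi_prM _ _)) _.
  exact: pr_rel (rel_hM D xi g h).
- by move=> g gL; exact: (pr_rel (rel_xi xi gL)).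
- by move=> h; apply: twist; apply: rel_hx.
- by move=> h; apply: twist; apply: rel_hy.
- apply: etrans (esym (axi_prX _ _)) _; apply: etrans (pr_rel (rel_xr D xi)) _.
  exact: pc1.
- rewrite -(ordsE axD nu0); apply: etrans (esym (axi_prX _ _)) _.
  by apply: etrans (pr_rel (rel_ys D xi)) _; apply: pc1.
- apply: etrans (esym (axi_prM _ _)) _; apply: etrans (pr_rel (rel_xy D xi)) _.
  apply: etrans (prD _ _ _) _.
  apply: congr2; first exact: etrans (axi_prZ _ _) (congr1 _ (axi_prM _ _)).
  exact: etrans (axi_prZ _ _) (congr1 _ (pr_zmod_morphism _ _ _)).
Qed.

Lemma axi_gen_ind (P : Axi D xi -> Prop) : P 1 ->
  (forall a b, P a -> P b -> P (a + b)) ->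
  (forall c b, P b -> P (axi_scalar c * b)) ->
  (forall b, P b -> P (genX D xi * b)) -> (forall b, P b -> P (genY D xi * b)) ->
  (forall h b, P b -> P (genH D xi h * b)) -> forall a, P a.
Proof.
move=> P1 PD Psc Px Py Ph.
apply: (@presAlg_gen_ind _ _ _ P P1 PD) => [c a Pa|[[]|h] a Pa].
- by rewrite axi_scaleE; apply: Psc.
- exact: Px.
- exact: Py.
- exact: Ph.
Qed.

Lemma defines_L_standard eta c (rho : {rmorphism Axi D xi -> 'M[k]_(ordr D)}) :
  defines_L eta c rho ->
  standard_rep eta axi_scalar (genX D xi) (genY D xi) (genH D xi) rho c.
Proof.
case=> rZ rx ry rh; split=> //.
by move=> a; rewrite -[LHS]/(rho (axi_scalar a)) axi_scalarE rZ rmorph1 scalemx1.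
Qed.

End ScalarsOfAxi.

(** * Construction of [L(eta, c)] from a solution [c] *)

Section Existence.
Variables (k : fieldType) (gT : finGroupType) (D : qp_data k gT).
Variables xi eta : gT -> k.
Hypotheses (axD : qp_axioms D) (nu_neq0 : nu D != 0).
Hypotheses (alpha1 : alpha D xi = 1) (beta1 : beta D xi = 1).
Hypothesis eta_F : in_F D xi eta.

Local Notation chi1 := (chi1 D).
Local Notation r := (ordr D).
Local Notation F := (fvec axD).
Let r0 := ordr_gt0 axD.

Definition mx_of_columns (f : 'I_r -> 'cV[k]_r) : 'M[k]_r := \matrix_(i, j) f j i 0.

Lemma mx_of_columnsE f j : mx_of_columns f *m fbasis j = f j.
Proof. by apply/colP => i; rewrite -colE !mxE. Qed.

Lemma exists_rep c : star D eta c ->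
  exists rho : {rmorphism Axi D xi -> 'M[k]_r}, defines_L eta c rho.
Proof.
move=> cstar; have [etaC etaL] := eta_F.
pose X := mx_of_columns (fun i => fbasis (ordS i)).
pose Y := mx_of_columns (fun i => cseq D eta c i *: fbasis (ord_pred i)).
pose T h := mx_of_columns (fun i => (chi1 h ^+ i * eta h) *: fbasis i).
have XF n : X *m F n = F n.+1 by rewrite mx_of_columnsE fbasis_ordS.
have YF n : Y *m F n.+1 = cseq D eta c n.+1 *: F n.
  rewrite mx_of_columnsE fbasis_ord_pred.
  by rewrite /= (cseq_mod eta axD nu_neq0 alpha1 c n.+1).
have TF h n : T h *m F n = (chi1 h ^+ n * eta h) *: F n.
  by rewrite mx_of_columnsE /= (expr_mod n (chi1_exp_r axD alpha1 h)).
have XnF m n : X ^+ m *m F n = F (n + m).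
  elim: m => [|m IHm]; first by rewrite expr0 mul1mx addn0.
  by rewrite exprS -[X * _]/(X *m _) -mulmxA IHm XF addnS.
(* The factors start at [n.+1] because lowering [f_(j+1)] to [f_j] costs [c_(j+1)]; for [m = r] they
   fill one period. *)
have YnF m n : Y ^+ m *m F (n + m) = (\prod_(i < m) cseq D eta c (n.+1 + i)) *: F n.
  elim: m => [|m IHm]; first by rewrite expr0 mul1mx addn0 big_ord0 scale1r.
  rewrite exprSr -[_ * Y]/(_ *m Y) -mulmxA addnS YF -scalemxAr IHm scalerA.
  by rewrite big_ord_recr /= mulrC.
have YXF n : Y *m (X *m F n) = cseq D eta c n.+1 *: F n by rewrite XF YF.
have XYF n : X *m (Y *m F n) = cseq D eta c n *: F n.
  rewrite [in LHS](fvec_pred axD) YF -scalemxAr XF -(fvec_pred axD).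
  by rewrite -addnS prednK // (cseq_periodic eta axD nu_neq0 alpha1).
pose gen (i : qp_gen gT) : 'M[k]_r := match i with
  | inl true => X | inl false => Y | inr h => T h end.
have [L LZ Lgen] := freeAlg_lift gen r0.
have LX : L (freeX k gT) = X by apply: Lgen.
have LY : L (freeY k gT) = Y by apply: Lgen.
have LT h : L (freeH k h) = T h by apply: Lgen.
have LM u v n : L (u * v) *m F n = L u *m (L v *m F n).
  by rewrite rmorphM -mulmxA.
have LD u v n : L (u + v) *m F n = L u *m F n + L v *m F n.
  by rewrite rmorphD mulmxDl.
have LB1 u : L (u - 1) = L u - 1 by rewrite rmorphB rmorph1.
have LZF a u n : L (a *: u) *m F n = a *: (L u *m F n).
  by rewrite LZ -scalemxAl.
have Lsc a n : L (a *: 1) *m F n = a *: F n.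
  by rewrite LZ rmorph1 -scalemxAl mul1mx.
have [rho rhoZ rhoE] : exists2 rho : {rmorphism Axi D xi -> 'M[k]_r},
    scalable rho & forall u, rho (pr _ u) = L u.
  apply: (presAlg_lift LZ) => u v uv; apply: (mx_fvec_inj (axD := axD)) => n.
  case: uv => {u v} [|g h|g gL|h|h|||].
  - by rewrite LT rmorph1 TF mul1mx etaC.1 (chi1_char axD).1 expr1n mulr1 scale1r.
  - rewrite (LM (freeH k g)) !LT !TF -scalemxAr TF scalerA.
    by rewrite (chi1M axD) etaC.2 ?inE // exprMn [in RHS]mulrACA mulrC.
  - rewrite Lsc LT TF etaL //; move: gL; rewrite inE => /andP[/eqP -> _].
    by rewrite expr1n mul1r.
  - rewrite (LM (freeH k h)) (LZF _ (freeX k gT * _)) (LM (freeX k gT)).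
    by rewrite LT LX XF !TF -scalemxAr XF scalerA exprS mulrA.
  (* With [f_n] written as [f_(m+1)], the two sides differ by one factor [chi1 h], which [chi2 h]
     cancels. *)
  - rewrite (LM (freeH k h)) (LZF _ (freeY k gT * _)) (LM (freeY k gT)) LT LY.
    rewrite (fvec_pred axD n) YF TF -!scalemxAr TF YF !scalerA; congr (_ *: _).
    move: (cseq _ _ _ _) => a; rewrite exprS chi2E // -!mulrA mulKf ?chi1_neq0 //.
    by rewrite [in RHS]mulrA mulrC.
  - by rewrite Lsc alpha1 rmorphXn LX XnF fvecDr scale1r.
  (* Here the equation on [c] enters: [f_n] is [f_(n+r)], and [Y ^+ r] multiplies it by a full
     period of the [c_i], which is 1. *)
  - rewrite Lsc beta1 rmorphXn LY ordsE // -[in LHS](fvecDr axD n) YnF.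
    by rewrite (star_shift axD nu_neq0 alpha1).
  (* On [f_n] both sides are scalars, and their equality is the recursion for [c_(n+1)] multiplied
     by [chi2 g1], the inverse of [q]. *)
  - rewrite [in RHS]LD (LM (freeX k gT) (freeY k gT)).
    rewrite (LZF _ (freeY k gT * freeX k gT)) (LM (freeY k gT) (freeX k gT)).
    rewrite (LZF _ (freeH k _ - 1)) LB1 LX LY LT XYF YXF.
    rewrite mulmxBl mul1mx TF.
    rewrite -[X in _ - X]scale1r -scalerBl !scalerA -scalerDl; congr (_ *: _).
    rewrite /= /cstep chi2E // mulrA mulVf ?chi1_neq0 // mul1r.
    by rewrite [eta _ * _]mulrC subrK.
exists rho; split=> //.
- by move=> i; rewrite rhoE LX mx_of_columnsE.
- by move=> i; rewrite rhoE LY mx_of_columnsE.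
- by move=> h i; rewrite rhoE LT mx_of_columnsE.
Qed.
End Existence.

(** * Integer exponents, simple roots, and the classification *)

Lemma expfz_mod (F : fieldType) (x : F) (n : nat) (m : int) :
  (0 < n)%N -> x ^+ n = 1 -> x ^ m = x ^+ `|(m %% n%:Z)%Z|%N.
Proof.
move=> n0 xn.
have x0 : x != 0.
  by apply/eqP => x0; move/eqP: xn; rewrite x0 expr0n gtn_eqF // eq_sym oner_eq0.
rewrite [in LHS](divz_eq m n%:Z) expfzDr // -exprz_exp exprzAC -exprnP xn exp1rz.
by rewrite mul1r exprnP gez0_abs // modz_ge0 // eqz_nat -lt0n.
Qed.

Lemma simple_roots_split (k : closedFieldType) (p : {poly k}) : simple_roots p ->
  exists (s : seq k) (a : k),
    [/\ uniq s, a != 0 & p = a *: \prod_(c <- s) ('X - c%:P)].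
Proof.
(* For [p = 0] the exponents over which [mup] maximises are bounded by the size 0, so the
   multiplicity of the root 0 would be 0 instead of 1. *)
move=> p1; have p0 : p != 0.
  apply/eqP => p0; have := p1 0; rewrite p0 root0 => /(_ isT).
  rewrite /mup; case: arg_maxnP => [|[i /=]]; first by rewrite expr0 dvd1p.
  by rewrite size_poly0 => + _ _ i1; rewrite i1.
have [s sE] := closed_field_poly_normal p.
have a0 : lead_coef p != 0 by rewrite lead_coef_eq0.
exists s, (lead_coef p); split=> //; apply/count_mem_uniq => c.
have [cs|/count_memPn-> //] := boolP (c \in s).
have rc : root p c.
  by rewrite sE /root hornerZ mulf_eq0 (negPf a0) -/(root _ _) root_prod_XsubC.
have := p1 c rc; rewrite sE -mul_polyC mupMr ?mu_prod_XsubC //.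
by rewrite /root hornerC.
Qed.

Theorem theorem3p7
  (k : closedFieldType) (pchar_k0 : [pchar k] =i pred0)
  (gT : finGroupType) (abelian_gT : abelian [set: gT])
  (D : qp_data k gT) (axD : qp_axioms D)
  (xi : gT -> k) (xi_char : is_char (Lambda D) xi)
  (alpha1 : alpha D xi = 1) (beta1 : beta D xi = 1) (nu_neq0 : nu D != 0)
  (eta : gT -> k) (eta_F : in_F D xi eta) :
  [/\
    (* (i) *)
    forall c : k, c != 0 ->
      ((exists rho : {rmorphism Axi D xi -> 'M[k]_(ordr D)},
          defines_L eta c rho) <-> star D eta c) /\
      (forall rho : {rmorphism Axi D xi -> 'M[k]_(ordr D)},
          defines_L eta c rho -> irreducible_module (repmod rho)),
    (* (ii) *)
    forall (c : k) (eta' : gT -> k) (c' : k)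
           (rho rho' : {rmorphism Axi D xi -> 'M[k]_(ordr D)}),
      star D eta c -> in_F D xi eta' -> star D eta' c' ->
      defines_L eta c rho -> defines_L eta' c' rho' ->
      (isomorphic_modules (repmod rho) (repmod rho') <->
       exists m : int,
         (forall h, eta h = eta' h * chi1 D h ^ m) /\
         c = cseq D eta' c' `|(m %% (ordr D)%:Z)%Z|%N) &
    (* (iii) *)
    simple_roots (star_poly D eta) ->
      (forall M : lmodType (Axi D xi), irreducible_module M ->
        exists (eta' : gT -> k) (c' : k)
               (rho' : {rmorphism Axi D xi -> 'M[k]_(ordr D)}),
          [/\ in_F D xi eta', star D eta' c', defines_L eta' c' rho' &
              isomorphic_modules M (repmod rho')]) /\
      semisimple_algebra (Axi D xi)].
Proof.
have relA := axi_relations axD nu_neq0 alpha1 beta1.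
have genA := @axi_gen_ind k gT D xi.
have r0 := ordr_gt0 axD.
split.
- move=> c c0; split; last first.
    move=> rho /defines_L_standard rhoL.
    exact: (standard_rep_irreducible axD alpha1 eta_F relA rhoL).
  split=> [[rho /defines_L_standard rhoL]|cstar].
    exact: (rep_star axD nu_neq0 alpha1 relA rhoL).
  exact: exists_rep.
- move=> c eta' c' rho rho' cstar eta'_F c'star.
  move=> /defines_L_standard rhoL /defines_L_standard rhoL'.
  have irr := standard_rep_irreducible axD alpha1 eta_F relA rhoL.
  have irr' := standard_rep_irreducible axD alpha1 eta'_F relA rhoL'.
  split=> [[f /bij_inj finj]|[m [etaE cE]]].
    (* The image of [f_0] is a nonzero vector of weight [eta] with [z]-eigenvalue [c]; the index of
       a nonzero coordinate in [L(eta', c')] serves as [m]. *)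
    have sf := standard_linear f (fvec0_standard axD nu_neq0 alpha1 relA rhoL).
    have f0 : f (fvec axD 0) != 0.
      by rewrite -(linear0 f) (inj_eq finj); apply: fvec_neq0.
    have [i [etaE cE]] := standard_coord axD nu_neq0 alpha1 relA rhoL' sf f0.
    exists i%:Z; rewrite modz_nat modn_small //; split=> // h.
    by rewrite etaE mulrC.
  have etaE' h : eta h = chi1 D h ^+ `|(m %% (ordr D)%:Z)%Z|%N * eta' h.
    by rewrite etaE mulrC (expfz_mod m r0 (chi1_exp_r axD alpha1 h)).
  (* Conversely, the basis vector of [L(eta', c')] with index [m] modulo [r] satisfies the relations
     of [f_0] in [L(eta, c)]. *)
  have sF := standard_fvec axD nu_neq0 alpha1 relA rhoL' etaE'.
  rewrite -cE in sF.
  apply: (standard_iso axD nu_neq0 alpha1 eta_F relA rhoL genA irr' sF).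
  exact: fvec_neq0.
- move=> /simple_roots_split[s [a [us a0 sE]]].
  have gen M := @standard_generated _ _ _ _ _ axD nu_neq0 alpha1 eta_F _ _ _ _ _
    relA M s a us a0 sE.
  split.
    move=> M irrM; have [[v v0] _] := irrM.
    have [l lP lS] := gen M v.
    (* If all generators were zero, the zero submodule would contain [v]. *)
    have [u ul u0] : exists2 u, u \in l & u != 0.
      apply: contrapT => ln; case/eqP: v0; apply/eqP.
      apply: (lS (fun v => v == 0)) => [|u ul].
        split=> [|b u w /eqP-> /eqP->]; first exact: eqxx.
        by rewrite scaler0 addr0; exact: eqxx.
      by apply: contrapT => /negP u0; apply: ln; exists u.
    have [c cstar su] := lP u ul.
    have [rho rhoD] := exists_rep axD nu_neq0 alpha1 beta1 eta_F cstar.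
    (* [eta] itself serves as [eta'], since the generator [u] has weight [eta]. *)
    exists eta, c, rho; split=> //; apply: isomorphic_modules_sym.
    have rhoL := defines_L_standard rhoD.
    exact: (standard_iso axD nu_neq0 alpha1 eta_F relA rhoL genA irrM su).
  (* In the regular module finitely many standard vectors generate 1, and each of them is simple. *)
  have [l lP lS] := gen ((Axi D xi)^o : lmodType (Axi D xi)) (1 : Axi D xi).
  apply: (semisimple_algebra_generated _ lS) => v /lP[c cstar sv].
  have [rho rhoD] := exists_rep axD nu_neq0 alpha1 beta1 eta_F cstar.
  have rhoL := defines_L_standard rhoD.
  exact: (standard_simple axD nu_neq0 alpha1 eta_F relA rhoL genA sv).
Qed.
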